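(* For real $\nu$ let $I_\nu$ denote the modified Bessel function of the first kind, and define $\Phi_\nu:(0,\infty)\to(0,\infty)$ by $$\Phi_{\nu}(x)=e^{-x}x^{-\nu}\left[I_{\nu}(x)+I_{\nu+1}(x)\right].$$ Then the following hold: (a) $\Phi_\nu$ is completely monotonic on $(0,\infty)$ for all $\nu\ge -\tfrac12$; (b) $\Phi_\nu$ is log-convex and geometrically concave on $(0,\infty)$ for all $\nu\ge-\tfrac12$; (c) for every $x>0$, the map $\nu\mapsto\Phi_\nu(x)$ is decreasing on $[0,\infty)$; (d) $x\mapsto x^{\nu+\frac12}\Phi_\nu(x)$ is increasing on $(0,\infty)$ for all $\nu\ge-\tfrac12$; (e) $x\mapsto \left(x+\frac{\nu}{2}\right)^{\nu+\frac12}\Phi_\nu(x)$ is increasing on $(0,\infty)$ for all $\nu\ge-\tfrac12$; (f) $x\mapsto \left(x+\frac{\nu}{2}+\frac14\right)^{\nu+\frac12}\Phi_\nu(x)$ is increasing on $(0,\infty)$ for all $\nu\ge-\tfrac12$; (g) for all $\nu>-\tfrac12$ and $x>0$, $$\frac{\left(\nu+\frac{1}{2}\right)^{\nu+\frac{1}{2}}}{2^{2\nu+\frac{1}{2}}\Gamma(\nu+1)\left(x+\frac{\nu}{2}+\frac{1}{4}\right)^{\nu+\frac{1}{2}}}<\Phi_{\nu}(x)<\sqrt{\frac{2}{\pi}}\cdot\frac{1}{\left(x+\frac{\nu}{2}+\frac{1}{4}\right)^{\nu+\frac{1}{2}}}.$$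
   Context: A function $f:(0,\infty)\to\mathbb{R}$ is completely monotonic if it has derivatives of all orders and $(-1)^m f^{(m)}(x)\ge 0$ for all $x>0$ and $m\in\{0,1,2,\dots\}$. A positive function $g$ is log-convex if $\ln g$ is convex. A positive function $h$ on $(0,\infty)$ is geometrically concave if $h(x^\lambda y^{1-\lambda})\ge [h(x)]^\lambda[h(y)]^{1-\lambda}$ for all $x,y>0$, $\lambda\in[0,1]$ (equivalently, $\ln h$ is a concave function of $\ln x$).
   Formalization: Part (e) is stated only for those x>0 with x+ν/2>0, since for -1/2<ν<0 and x<-ν/2 the base is negative and the real power (x+ν/2)^(ν+1/2) is undefined; increasing and decreasing are read as non-strict. *)

(* Defs.v *)
From Stdlib Require Import Reals.
From Coquelicot Require Import Coquelicot.
Open Scope R_scope.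

(* Euler's Gamma function for s > 0: Gamma s = int_0^oo t^(s-1) e^(-t) dt
   (improper Riemann integral). Only used at arguments s >= 1/2. *)
Definition Gamma (s : R) : R :=
  RInt_gen (fun t => Rpower t (s - 1) * exp (- t)) (at_right 0) (Rbar_locally p_infty).

Definition BesselI (nu x : R) : R :=
  Series (fun k : nat => Rpower (x / 2) (2 * INR k + nu) / (INR (Factorial.fact k) * Gamma (INR k + nu + 1))).

Definition Phi (nu x : R) : R :=
  exp (- x) * Rpower x (- nu) * (BesselI nu x + BesselI (nu + 1) x).

Definition completely_monotonic (f : R -> R) : Prop :=
  forall (m : nat) (x : R), 0 < x ->
    ex_derive_n f m x /\ 0 <= (-1) ^ m * Derive_n f m x.

Definition log_convex_pos (f : R -> R) : Prop :=
  (forall x, 0 < x -> 0 < f x) /\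
  forall x y l, 0 < x -> 0 < y -> 0 <= l <= 1 ->
    ln (f (l * x + (1 - l) * y)) <= l * ln (f x) + (1 - l) * ln (f y).

Definition geom_concave_pos (f : R -> R) : Prop :=
  (forall x, 0 < x -> 0 < f x) /\
  forall x y l, 0 < x -> 0 < y -> 0 <= l <= 1 ->
    Rpower (f x) l * Rpower (f y) (1 - l) <= f (Rpower x l * Rpower y (1 - l)).

(* Main.v *)
Require Import Defs.
From Stdlib Require Import Reals Lra Lia.
From Coquelicot Require Import Coquelicot.
Open Scope R_scope.

(* Put a = nu + 1/2 >= 0 and K = 2^-nu / Gamma (nu + 1). The pair (x^-nu I_nu, x^-nu I_(nu+1))
   solves A' = B, B' = A - (2a/x) B, and so does a combination of the Kummer functions M(a+1, 2a+1, 2x)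
   and M(a, 2a+1, 2x). Hence Phi_nu = K g with g = e^(-2x) M(a+1, 2a+1, 2x), and together with
   h = e^(-2x) M(a, 2a+1, 2x) one has x g' = a (h - g), x h' = a (g - h) - 2 x h.
   (a) Differentiating e^(-z) M(c, b, z) multiplies by -(b-c)/b and raises b by 1.
   (b) Geometric concavity is D := a (g^2 - h^2) - 2 x g h <= 0 and log-convexity is
   E := - D - g (g - h) <= 0; both D and E satisfy a linear equation with integrating factor
   x^(2a) e^(2x), a right-hand side of constant sign and zero initial value.
   (d)-(f) D <= 0 gives a (g - h) < 2 x h, i.e. -g'/g < a / (x + a/2).
   (c) The power series is compared termwise, since 2^nu Gamma (nu + 1) is nondecreasing on [0, oo).
   (g) By (f) the function (x + a/2)^a Phi_nu lies between its limits at 0 and at infinity. The latter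
   is bounded by comparing I_nu with I_(-1/2): Wendel's inequality for Gamma bounds I_(nu+p) by an
   interpolation between I_nu and I_(nu+1), up to a factor 1 + O(1/x). *)

(** The Bessel pair does not show the signs of its derivatives; on the Kummer side positivity, h <=
    g and complete monotonicity can be read off nonnegative coefficients. The price is the
    identification of the two pairs. The system is singular at x = 0, where its data live, so the
    derivative rules hold only for x > 0 and every initial value enters through continuity at 0. An
    energy estimate then replaces a uniqueness theorem. Both Gamma inequalities integrate a bound
    that is affine in t or in 1/t, with the base point c chosen so that t/c, respectively c/t, has
    mean 1 under the Gamma weight; the first-order term then integrates to nothing, and no
    differentiation under the integral is required. For (g) no asymptotic expansion of I_nu is used.
    One-sided estimates suffice: an upper bound for I_(-1/2), and Gamma (1/2) >= sqrt PI, since this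
    value stands in a denominator. At a = 0 the weighted functions are constant, which is why
    strictness appears only for a > 0. *)

(** * Elementary inequalities for exp, ln and real powers *)

Lemma ln_le_sub1 (x : R) : 0 < x -> ln x <= x - 1.
Proof.
  intros Hx. pose proof (exp_ineq1_le (ln x)) as H. rewrite exp_ln in H; lra.
Qed.

Lemma Rpower_pos (x y : R) : 0 < Rpower x y.
Proof. apply exp_pos. Qed.

Lemma Rpower_Rinv (x y : R) : 0 < x -> Rpower (/ x) y = / Rpower x y.
Proof.
  intros Hx. unfold Rpower. rewrite ln_Rinv, <- exp_Ropp by assumption. f_equal; ring.
Qed.

Lemma Rpower_Rdiv (x y z : R) : 0 < x -> 0 < y -> Rpower (x / y) z = Rpower x z / Rpower y z.
Proof.
  intros Hx Hy. unfold Rdiv. rewrite <- Rpower_mult_distr, Rpower_Rinv; auto.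
  now apply Rinv_0_lt_compat.
Qed.

(** Concavity of ln by tangents at the mean m = 1 - p + p x: the bounds ln u <= u - 1 at u = x/m and
    u = 1/m, weighted by p and 1 - p, have right-hand sides that sum to 0. *)
Lemma Rpower_le_chord (x p : R) : 0 < x -> 0 <= p <= 1 -> Rpower x p <= 1 - p + p * x.
Proof.
  intros Hx [Hp0 Hp1].
  destruct (Req_dec p 1) as [->|Hp]; [rewrite Rpower_1; lra|].
  set (m := 1 - p + p * x).
  assert (Hm : 0 < m) by (unfold m; nra).
  pose proof (ln_le_sub1 (x / m) ltac:(apply Rdiv_lt_0_compat; lra)) as H1.
  pose proof (ln_le_sub1 (1 / m) ltac:(apply Rdiv_lt_0_compat; lra)) as H2.
  unfold Rdiv in H1, H2.
  rewrite ln_mult, ln_Rinv in H1 by (try apply Rinv_0_lt_compat; lra).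
  rewrite Rmult_1_l, ln_Rinv in H2 by lra.
  assert (H : p * ln x <= ln m).
  { assert (p * (ln x - ln m) + (1 - p) * (- ln m) <= p * (x * / m - 1) + (1 - p) * (/ m - 1))
      by (apply Rplus_le_compat; apply Rmult_le_compat_l; lra).
    replace (p * (x * / m - 1) + (1 - p) * (/ m - 1)) with 0 in H; [lra|].
    unfold m in *; field; lra. }
  unfold Rpower. rewrite <- (exp_ln m Hm).
  destruct (Req_dec (p * ln x) (ln m)) as [->|]; [lra|].
  left; apply exp_increasing; lra.
Qed.

Lemma Rpower_weighted_amgm (x y p : R) : 0 < x -> 0 < y -> 0 <= p <= 1 ->
  Rpower x p * Rpower y (1 - p) <= p * x + (1 - p) * y.
Proof.
  intros Hx Hy Hp.
  pose proof (Rpower_le_chord (x / y) p ltac:(apply Rdiv_lt_0_compat; lra) Hp) as H.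
  rewrite Rpower_Rdiv in H by assumption.
  apply (Rmult_le_compat_r y) in H; [|lra].
  replace ((1 - p + p * (x / y)) * y) with (p * x + (1 - p) * y) in H by (field; lra).
  eapply Rle_trans; [|exact H]. right.
  unfold Rminus. rewrite Rpower_plus, Rpower_Ropp, Rpower_1 by assumption.
  field. apply Rgt_not_eq, Rpower_pos.
Qed.

Lemma exp_le (x y : R) : x <= y -> exp x <= exp y.
Proof. intros [H| ->]; [left; now apply exp_increasing|lra]. Qed.

(** The bound is affine in 1/x, not in x: Bernoulli's 1 + p (x - 1) is a lower bound only for p >=
    1, whereas ln x >= 1 - 1/x serves every p >= 0. *)
Lemma Rpower_ge_tangent (x p : R) : 0 < x -> 0 <= p -> 1 + p * (1 - / x) <= Rpower x p.
Proof.
  intros Hx Hp.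
  pose proof (ln_le_sub1 (/ x) ltac:(now apply Rinv_0_lt_compat)) as H.
  rewrite ln_Rinv in H by assumption.
  eapply Rle_trans; [|apply exp_ineq1_le]. nra.
Qed.

(** * The Gamma function *)

(** Integrals of a positive function grow with the interval, so their supremum is the improper
    integral: once some [a0, b0] comes within eps of it, every larger interval does. *)
Lemma is_RInt_gen_0_infty_of_bounded (f : R -> R) (M : R) :
  (forall t, 0 < t -> continuous f t) -> (forall t, 0 < t -> 0 < f t) ->
  (forall a b, 0 < a -> a <= b -> RInt f a b <= M) ->
  exists l, 0 < l /\ is_RInt_gen f (at_right 0) (Rbar_locally p_infty) l.
Proof.
  intros Hc Hp HM.
  assert (Hex : forall a b, 0 < a -> 0 < b -> ex_RInt f a b).
  { intros a b Ha Hb. apply (ex_RInt_continuous (V := R_CompleteNormedModule)).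
    intros t [Ht _]. apply Hc. unfold Rmin in Ht. destruct (Rle_dec a b); lra. }
  assert (Hpos : forall a b, 0 < a -> a <= b -> 0 <= RInt f a b).
  { intros a b Ha Hab. apply RInt_ge_0; auto. { apply Hex; lra. }
    intros t Ht. left; apply Hp; lra. }
  destruct (completeness (fun r => exists a b, 0 < a /\ a <= b /\ r = RInt f a b))
    as [l [Hub Hlub]].
  { exists M. intros r (a & b & Ha & Hab & ->). auto. }
  { exists (RInt f 1 2), 1, 2. repeat split; lra. }
  exists l. split.
  { apply Rlt_le_trans with (RInt f 1 2).
    - apply RInt_gt_0; [lra|intros; apply Hp; lra|]. intros t Ht; apply Hc; lra.
    - apply Hub. exists 1, 2. repeat split; lra. }
  apply filterlimi_locally.
  intros eps.
  assert (H : exists a b, 0 < a /\ a <= b /\ l - eps < RInt f a b).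
  { apply Classical_Prop.NNPP. intros Hn.
    assert (l <= l - eps); [|destruct eps; simpl in *; lra].
    apply Hlub. intros r (a & b & Ha & Hab & ->).
    apply Rnot_lt_le. intros Hlt. apply Hn. now exists a, b. }
  destruct H as (a0 & b0 & Ha0 & Hab0 & Hl).
  apply (Filter_prod _ _ _ (fun a => 0 < a < a0) (fun b => b0 < b)).
  - exists (mkposreal a0 Ha0). intros y Hy Hy0. unfold ball in Hy; simpl in Hy.
    unfold AbsRing_ball, abs, minus, plus, opp in Hy; simpl in Hy.
    rewrite Ropp_0, Rplus_0_r, Rabs_right in Hy; lra.
  - exists b0. auto.
  - intros a b [Ha Haa] Hb. exists (RInt f a b). split.
    + apply (RInt_correct (V := R_CompleteNormedModule)), Hex; lra.
    + unfold ball; simpl. unfold AbsRing_ball, abs, minus, plus, opp; simpl.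
      assert (RInt f a b <= l) by (apply Hub; exists a, b; repeat split; lra).
      assert (RInt f a b = RInt f a a0 + RInt f a0 b0 + RInt f b0 b).
      { pose proof (RInt_Chasles f a a0 b0 ltac:(apply Hex; lra) ltac:(apply Hex; lra)) as H1.
        pose proof (RInt_Chasles f a b0 b ltac:(apply Hex; lra) ltac:(apply Hex; lra)) as H2.
        unfold plus in H1, H2; simpl in H1, H2. lra. }
      pose proof (Hpos a a0 ltac:(lra) ltac:(lra)).
      pose proof (Hpos b0 b ltac:(lra) ltac:(lra)).
      apply Rabs_def1; destruct eps; simpl in *; lra.
Qed.

Lemma is_RInt_gen_0_infty_derive (F f : R -> R) (la lb : R) :
  (forall t, 0 < t -> is_derive F t (f t)) -> (forall t, 0 < t -> continuous f t) ->
  filterlim F (at_right 0) (locally la) -> filterlim F (Rbar_locally p_infty) (locally lb) ->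
  is_RInt_gen f (at_right 0) (Rbar_locally p_infty) (lb - la).
Proof.
  intros Hd Hc Ha Hb.
  assert (Hf : forall P : R -> Prop, (forall t, 0 < t -> P t) ->
    filter_prod (at_right 0) (Rbar_locally p_infty) (fun ab : R * R =>
      forall t, Rmin (fst ab) (snd ab) <= t <= Rmax (fst ab) (snd ab) -> P t)).
  { intros P HP. apply (Filter_prod _ _ _ (fun a => 0 < a) (fun b => 0 < b)).
    - exists (mkposreal 1 Rlt_0_1). auto.
    - exists 0. auto.
    - simpl. intros a b Ha' Hb' t [Ht _]. apply HP. unfold Rmin in Ht.
      destruct (Rle_dec a b); lra. }
  apply (is_RInt_gen_ext (Derive F)).
  - eapply filter_imp; [|apply (Hf (fun t => Derive F t = f t))].
    + intros ab H t Ht. apply H; lra.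
    + intros t Ht. now apply is_derive_unique, Hd.
  - apply is_RInt_gen_Derive; auto.
    + apply Hf. intros t Ht. exists (f t). auto.
    + apply Hf. intros t Ht. apply (continuous_ext_loc _ f); auto.
      exists (mkposreal t Ht). intros y Hy. symmetry. apply is_derive_unique, Hd.
      apply Rabs_def2 in Hy. simpl in Hy. unfold minus, plus, opp in Hy; simpl in Hy. lra.
Qed.

Lemma is_RInt_gen_0_infty_le (f g : R -> R) (lf lg : R) :
  (forall t, 0 < t -> f t <= g t) ->
  is_RInt_gen f (at_right 0) (Rbar_locally p_infty) lf ->
  is_RInt_gen g (at_right 0) (Rbar_locally p_infty) lg -> lf <= lg.
Proof.
  intros Hle Hf Hg.
  pose proof (is_RInt_gen_minus _ _ _ _ Hg Hf) as H.
  (* The zero function is dominated by g - f, so the norm inequality for improper integrals bounds 0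
     by lg - lf. *)
  pose proof (is_RInt_gen_scal _ 0 _ H) as H0.
  assert (0 <= minus lg lf); [|unfold minus, plus, opp in *; simpl in *; lra].
  eapply Rle_trans; [apply (norm_ge_0 (V := R_NormedModule) (scal 0 (minus lg lf)))|].
  refine (RInt_gen_norm (V := R_CompleteNormedModule) _ _ _ _ _ _ H0 H).
  - apply (Filter_prod _ _ _ (fun a => a < 1) (fun b => 1 < b)).
    + exists (mkposreal 1 Rlt_0_1). intros y Hy _. apply Rabs_def2 in Hy. simpl in Hy.
      unfold minus, plus, opp in Hy; simpl in Hy. lra.
    + exists 1. auto.
    + simpl. intros; lra.
  - apply (Filter_prod _ _ _ (fun a => 0 < a) (fun b => 1 < b)).
    + exists (mkposreal 1 Rlt_0_1). auto.
    + exists 1. auto.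
    + simpl. intros a b Ha Hb t Ht. unfold scal; simpl. unfold mult; simpl.
      rewrite Rmult_0_l. unfold norm; simpl. unfold abs; simpl. rewrite Rabs_R0.
      specialize (Hle t ltac:(lra)). unfold minus, plus, opp; simpl. lra.
Qed.

Definition gamma_integrand (s t : R) : R := Rpower t (s - 1) * exp (- t).

Lemma gamma_integrand_succ (s t : R) : 0 < t ->
  gamma_integrand (s + 1) t = t * gamma_integrand s t.
Proof.
  intros Ht. unfold gamma_integrand. replace (s + 1 - 1) with (s - 1 + 1) by ring.
  rewrite Rpower_plus, Rpower_1 by assumption. ring.
Qed.

Lemma gamma_integrand_pos (s t : R) : 0 < gamma_integrand s t.
Proof. apply Rmult_lt_0_compat; apply exp_pos. Qed.

Lemma is_derive_gamma_integrand (s t : R) : 0 < t ->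
  is_derive (gamma_integrand s) t ((s - 1) * gamma_integrand (s - 1) t - gamma_integrand s t).
Proof.
  intros Ht. replace (gamma_integrand s t) with (t * gamma_integrand (s - 1) t).
  2:{ rewrite <- gamma_integrand_succ by assumption. f_equal; ring. }
  unfold gamma_integrand, Rpower. auto_derive; [assumption|].
  replace ((s - 1) * ln t) with ((s - 1 - 1) * ln t + ln t) by ring.
  rewrite exp_plus, exp_ln by assumption. field. lra.
Qed.

Lemma continuous_gamma_integrand (s t : R) : 0 < t -> continuous (gamma_integrand s) t.
Proof.
  intros Ht. apply (ex_derive_continuous (V := R_NormedModule)).
  eexists. now apply is_derive_gamma_integrand.
Qed.

Lemma exp_opp_le_Rpower (s : R) : 0 < s ->
  exists C, 0 < C /\ forall t, 0 < t -> exp (- t) <= C * Rpower (1 + t) (- s).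
Proof.
  (* The constant comes from ln u <= u - 1 at u = (1 + t)/s; a further factor e^(-s) is dropped. *)
  intros Hs. exists (exp (1 + s * ln s)). split; [apply exp_pos|].
  intros t Ht. unfold Rpower. rewrite <- exp_plus. apply exp_le.
  pose proof (ln_le_sub1 ((1 + t) / s) ltac:(apply Rdiv_lt_0_compat; lra)) as H.
  unfold Rdiv in H. rewrite ln_mult, ln_Rinv in H by (try apply Rinv_0_lt_compat; lra).
  apply (Rmult_le_compat_l s) in H; [|lra].
  replace (s * ((1 + t) * / s - 1)) with (1 + t - s) in H by (field; lra). lra.
Qed.

Lemma is_RInt_gen_Gamma (s : R) : 0 < s ->
  0 < Gamma s /\ is_RInt_gen (gamma_integrand s) (at_right 0) (Rbar_locally p_infty) (Gamma s).
Proof.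
  intros Hs.
  (* With exponent s + 1 the majorant C t^(s-1) (1+t)^(-s-1) is integrable at both ends and has the
     explicit primitive (C/s) (t/(1+t))^s, which lies between 0 and C/s. *)
  destruct (exp_opp_le_Rpower (s + 1) ltac:(lra)) as (C & HC & HCb).
  set (H := fun t => C / s * Rpower (t / (1 + t)) s).
  assert (Hd : forall t, 0 < t ->
    is_derive H t (C * (Rpower t (s - 1) * Rpower (1 + t) (- (s + 1))))).
  { intros t Ht. unfold H, Rpower. auto_derive.
    - split; [lra|]. split; [|trivial]. apply Rdiv_lt_0_compat; lra.
    - replace (ln (t * / (1 + t))) with (ln t - ln (1 + t)).
      2:{ rewrite ln_mult, ln_Rinv by (try apply Rinv_0_lt_compat; lra). ring. }
      replace ((s - 1) * ln t) with (s * ln t + - ln t) by ring.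
      replace (- (s + 1) * ln (1 + t)) with (s * (- ln (1 + t)) + - ln (1 + t)) by ring.
      replace (s * (ln t - ln (1 + t))) with (s * ln t + s * - ln (1 + t)) by ring.
      rewrite !exp_plus, (exp_Ropp (ln t)), (exp_Ropp (ln (1 + t))), !exp_ln by lra.
      field. lra. }
  destruct (is_RInt_gen_0_infty_of_bounded (gamma_integrand s) (C / s)) as (l & Hl0 & Hl).
  - intros; now apply continuous_gamma_integrand.
  - intros; apply gamma_integrand_pos.
  - intros a b Ha Hab.
    assert (Hc : forall t, 0 < t -> continuous (fun t => C * (Rpower t (s - 1) * Rpower (1 + t) (- (s + 1)))) t).
    { intros t Ht. apply (ex_derive_continuous (V := R_NormedModule)). unfold Rpower. auto_derive. lra. }
    assert (HI : is_RInt (fun t => C * (Rpower t (s - 1) * Rpower (1 + t) (- (s + 1)))) a b (H b - H a)).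
    { apply (is_RInt_derive (V := R_CompleteNormedModule) H); intros t [Ht _];
        rewrite Rmin_left in Ht by assumption; [apply Hd|apply Hc]; lra. }
    apply Rle_trans with (H b - H a).
    + rewrite <- (is_RInt_unique _ _ _ _ HI). apply RInt_le; auto.
      * apply (ex_RInt_continuous (V := R_CompleteNormedModule)). intros t [Ht _].
        rewrite Rmin_left in Ht by assumption. apply continuous_gamma_integrand; lra.
      * eexists; exact HI.
      * intros t Ht. unfold gamma_integrand.
        pose proof (HCb t ltac:(lra)). pose proof (Rpower_pos t (s - 1)). nra.
    + assert (0 <= H a) by (apply Rmult_le_pos; [left; apply Rdiv_lt_0_compat; lra|left; apply Rpower_pos]).
      assert (H b <= C / s); [|lra].
      unfold H. rewrite <- (Rmult_1_r (C / s)) at 2. apply Rmult_le_compat_l.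
      * left; apply Rdiv_lt_0_compat; lra.
      * unfold Rpower. apply Rle_trans with (exp 0); [apply exp_le|rewrite exp_0; lra].
        pose proof (ln_le_sub1 (b / (1 + b)) ltac:(apply Rdiv_lt_0_compat; lra)) as Hln.
        assert (b / (1 + b) < 1).
        { apply (Rmult_lt_reg_r (1 + b)); [lra|]. unfold Rdiv. rewrite Rmult_assoc, Rinv_l. all: lra. }
        nra.
  - replace (Gamma s) with l; [auto|]. symmetry.
    apply (is_RInt_gen_unique (V := R_CompleteNormedModule) (gamma_integrand s)); exact Hl.
Qed.

Lemma Gamma_pos (s : R) : 0 < s -> 0 < Gamma s.
Proof. intros Hs. now apply is_RInt_gen_Gamma. Qed.

Lemma gamma_integrand_lim_infty (s : R) : 0 < s ->
  filterlim (gamma_integrand s) (Rbar_locally p_infty) (locally 0).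
Proof.
  intros Hs. destruct (exp_opp_le_Rpower s Hs) as (C & HC & HCb).
  apply filterlim_locally. intros eps. exists (1 + C / eps). intros t Ht.
  assert (0 < C / eps) by (apply Rdiv_lt_0_compat; [lra|apply cond_pos]).
  unfold ball; simpl. unfold AbsRing_ball, abs, minus, plus, opp; simpl.
  rewrite Ropp_0, Rplus_0_r, Rabs_right by (apply Rle_ge; left; apply gamma_integrand_pos).
  apply Rle_lt_trans with (C / t).
  - unfold gamma_integrand. apply Rle_trans with (Rpower t (s - 1) * (C * Rpower t (- s))).
    + apply Rmult_le_compat_l; [left; apply Rpower_pos|].
      eapply Rle_trans; [apply HCb; lra|]. apply Rmult_le_compat_l; [lra|].
      rewrite !Rpower_Ropp. apply Rinv_le_contravar; [apply Rpower_pos|].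
      apply Rle_Rpower_l; lra.
    + right. replace (Rpower t (s - 1) * (C * Rpower t (- s)))
        with (C * (Rpower t (s - 1) * Rpower t (- s))) by ring.
      rewrite <- Rpower_plus. replace (s - 1 + - s) with (- (1)) by ring.
      rewrite Rpower_Ropp, Rpower_1 by lra. reflexivity.
  - destruct eps as [e He]; simpl in *. apply Rlt_div_l; [lra|].
    replace C with (C / e * e) by (field; lra). nra.
Qed.

Lemma gamma_integrand_lim_0 (s : R) : 1 < s ->
  filterlim (gamma_integrand s) (at_right 0) (locally 0).
Proof.
  intros Hs. apply filterlim_locally. intros [e He].
  exists (mkposreal _ (Rpower_pos e (/ (s - 1)))). intros t Ht Ht0.
  apply Rabs_def2 in Ht. unfold minus, plus, opp in Ht; simpl in Ht.
  unfold ball; simpl. unfold AbsRing_ball, abs, minus, plus, opp; simpl.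
  rewrite Ropp_0, Rplus_0_r, Rabs_right by (apply Rle_ge; left; apply gamma_integrand_pos).
  apply Rle_lt_trans with (Rpower t (s - 1)).
  - unfold gamma_integrand. rewrite <- (Rmult_1_r (Rpower t (s - 1))) at 2.
    apply Rmult_le_compat_l; [left; apply Rpower_pos|].
    rewrite <- exp_0. apply exp_le; lra.
  - replace e with (Rpower (Rpower e (/ (s - 1))) (s - 1)).
    + apply Rlt_Rpower_l; lra.
    + rewrite Rpower_mult. replace (/ (s - 1) * (s - 1)) with 1 by (field; lra).
      now apply Rpower_1.
Qed.

(** Integration by parts: s t^(s-1) e^(-t) - t^s e^(-t) is the derivative of t^s e^(-t), which
    vanishes at both ends. *)
Lemma Gamma_succ (s : R) : 0 < s -> Gamma (s + 1) = s * Gamma s.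
Proof.
  intros Hs.
  destruct (is_RInt_gen_Gamma s Hs) as [_ H1].
  destruct (is_RInt_gen_Gamma (s + 1) ltac:(lra)) as [_ H2].
  assert (H0 : is_RInt_gen (fun t => s * gamma_integrand s t - gamma_integrand (s + 1) t)
            (at_right 0) (Rbar_locally p_infty) (0 - 0)).
  { apply (is_RInt_gen_0_infty_derive (gamma_integrand (s + 1))).
    - intros t Ht. pose proof (is_derive_gamma_integrand (s + 1) t Ht) as H.
      now replace (s + 1 - 1) with s in H by ring.
    - intros t Ht. apply (ex_derive_continuous (V := R_NormedModule)).
      apply (ex_derive_minus (V := R_NormedModule)); [apply ex_derive_scal|];
        eexists; now apply is_derive_gamma_integrand.
    - apply gamma_integrand_lim_0; lra.
    - apply gamma_integrand_lim_infty; lra. }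
  pose proof (is_RInt_gen_minus _ _ _ _ (is_RInt_gen_scal _ s _ H1) H2) as H3.
  pose proof (is_RInt_gen_unique (V := R_CompleteNormedModule) _ _ H3) as E3.
  pose proof (is_RInt_gen_unique (V := R_CompleteNormedModule) _ _ H0) as E0.
  unfold minus, plus, opp, scal in E3; simpl in E3. unfold mult in E3; simpl in E3.
  assert (E : 0 - 0 = s * Gamma s + - Gamma (s + 1)) by (rewrite <- E0, <- E3; reflexivity).
  lra.
Qed.

Lemma Gamma_1 : Gamma 1 = 1.
Proof.
  change (RInt_gen (gamma_integrand 1) (at_right 0) (Rbar_locally p_infty) = 1).
  apply (is_RInt_gen_unique (V := R_CompleteNormedModule) (gamma_integrand 1)).
  replace 1 with (0 - (-1)) at 2 by ring.
  apply (is_RInt_gen_0_infty_derive (fun t => - exp (- t))).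
  - intros t Ht. auto_derive; [trivial|].
    unfold gamma_integrand. replace (1 - 1) with 0 by ring. rewrite Rpower_O by assumption. ring.
  - intros t Ht. apply (continuous_gamma_integrand 1 t Ht).
  - apply (filterlim_filter_le_1 (F := locally 0)); [apply filter_le_within|].
    replace (-1) with (- exp (- 0)) by (rewrite Ropp_0, exp_0; reflexivity).
    apply (ex_derive_continuous (V := R_NormedModule) (fun t => - exp (- t)) 0). auto_derive. trivial.
  - replace 0 with (- 0) by ring.
    apply (filterlim_comp _ _ _ (fun t => exp (- t)) Ropp _ (locally 0));
      [|apply (continuous_opp (V := R_NormedModule) (fun t => t) 0), continuous_id].
    apply filterlim_ext_loc with (gamma_integrand 1); [|apply gamma_integrand_lim_infty; lra].
    exists 0. intros t Ht. unfold gamma_integrand. replace (1 - 1) with 0 by ring.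
    rewrite Rpower_O by assumption. ring.
Qed.

(** Three terms suffice, because an affine function of t or 1/t times a Gamma integrand is a
    combination of two integrands with neighbouring arguments. *)
Lemma Gamma_le_of_integrand_le (u v w A B C : R) : 0 < u -> 0 < v -> 0 < w ->
  (forall t, 0 < t ->
     A * gamma_integrand u t <= B * gamma_integrand v t + C * gamma_integrand w t) ->
  A * Gamma u <= B * Gamma v + C * Gamma w.
Proof.
  intros Hu Hv Hw H.
  pose proof (is_RInt_gen_scal _ A _ (proj2 (is_RInt_gen_Gamma u Hu))) as H1.
  pose proof (is_RInt_gen_scal _ B _ (proj2 (is_RInt_gen_Gamma v Hv))) as H2.
  pose proof (is_RInt_gen_scal _ C _ (proj2 (is_RInt_gen_Gamma w Hw))) as H3.
  refine (is_RInt_gen_0_infty_le _ _ _ _ _ H1 (is_RInt_gen_plus _ _ _ _ H2 H3)).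
  exact H.
Qed.

(* Integrate the bound t^(1-p) <= c^(1-p) (p + (1-p) t/c), with c = s + p, against the
   integrand of Gamma (s + p). *)
Lemma Gamma_Wendel (s p : R) : 0 < s -> 0 <= p <= 1 ->
  s * Gamma s <= Gamma (s + p) * Rpower (s + p) (1 - p).
Proof.
  intros Hs Hp. rewrite <- Gamma_succ by assumption.
  set (c := s + p). assert (Hc : 0 < c) by (unfold c; lra).
  set (r := Rpower c (1 - p)).
  pose proof (Gamma_le_of_integrand_le (s + 1) c (c + 1) 1 (r * p) (r * (1 - p) / c)
    ltac:(lra) Hc ltac:(lra)) as H.
  rewrite (Gamma_succ c), Rmult_1_l in H by assumption.
  replace (Gamma c * r) with (r * p * Gamma c + r * (1 - p) / c * (c * Gamma c)) by (field; lra).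
  apply H. intros t Ht.
  pose proof (Rpower_le_chord (t / c) (1 - p) ltac:(now apply Rdiv_lt_0_compat) ltac:(lra)) as Hch.
  rewrite Rpower_Rdiv in Hch by assumption. fold r in Hch.
  assert (Hr : 0 < r) by apply Rpower_pos.
  assert (Ht' : Rpower t (1 - p) <= r * (p + (1 - p) * (t / c))).
  { apply (Rmult_le_compat_l r) in Hch; [|lra].
    replace (r * (Rpower t (1 - p) / r)) with (Rpower t (1 - p)) in Hch by (field; lra). lra. }
  rewrite (gamma_integrand_succ c) by assumption.
  replace (gamma_integrand (s + 1) t) with (Rpower t (1 - p) * gamma_integrand c t).
  2:{ unfold gamma_integrand, c. rewrite <- Rmult_assoc, <- Rpower_plus. do 2 f_equal; ring. }
  pose proof (gamma_integrand_pos c t). apply (Rmult_le_compat_r (gamma_integrand c t)) in Ht'; [|lra].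
  replace (r * p * gamma_integrand c t + r * (1 - p) / c * (t * gamma_integrand c t)) with
    (r * (p + (1 - p) * (t / c)) * gamma_integrand c t) by (field; lra). lra.
Qed.

(* Integrate (t/c)^p >= 1 + p (1 - c/t), with c = s, against the integrand of Gamma (s + 1). *)
Lemma Gamma_add_ge (s p : R) : 0 < s -> 0 <= p ->
  Rpower s p * Gamma (s + 1) <= Gamma (s + 1 + p).
Proof.
  intros Hs Hp. set (r := Rpower s p).
  assert (Hr : 0 < r) by apply Rpower_pos.
  pose proof (Gamma_le_of_integrand_le (s + 1) s (s + 1 + p) (r * (1 + p)) (r * p * s) 1
    ltac:(lra) Hs ltac:(lra)) as H.
  rewrite (Gamma_succ s) in * by assumption.
  enough (r * (1 + p) * (s * Gamma s) <= r * p * s * Gamma s + 1 * Gamma (s + 1 + p)) by lra.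
  apply H. intros t Ht.
  pose proof (Rpower_ge_tangent (t / s) p ltac:(now apply Rdiv_lt_0_compat) Hp) as Ht'.
  rewrite Rpower_Rdiv in Ht' by assumption. fold r in Ht'.
  apply (Rmult_le_compat_l r) in Ht'; [|lra].
  replace (r * (Rpower t p / r)) with (Rpower t p) in Ht' by (field; lra).
  replace (gamma_integrand (s + 1 + p) t) with (Rpower t p * (t * gamma_integrand s t)).
  2:{ rewrite <- gamma_integrand_succ by assumption.
      unfold gamma_integrand. rewrite <- Rmult_assoc, <- Rpower_plus. do 2 f_equal; ring. }
  rewrite gamma_integrand_succ by assumption.
  pose proof (gamma_integrand_pos s t).
  apply (Rmult_le_compat_r (t * gamma_integrand s t)) in Ht'; [|nra].
  replace (r * (1 + p * (1 - / (t / s))) * (t * gamma_integrand s t)) with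
    (r * (1 + p) * (t * gamma_integrand s t) - r * p * s * gamma_integrand s t) in Ht'
    by (field; lra). lra.
Qed.

(** * Rising factorials and the monotonicity of 2^s Gamma(s) *)

Fixpoint poch (s : R) (n : nat) : R :=
  match n with O => 1 | S n => poch s n * (s + INR n) end.

Lemma poch_pos (s : R) (n : nat) : 0 < s -> 0 < poch s n.
Proof.
  intros Hs. induction n as [|n IH]; simpl; [lra|].
  apply Rmult_lt_0_compat; [assumption|]. pose proof (pos_INR n); lra.
Qed.

Lemma Gamma_add_INR (s : R) (n : nat) : 0 < s -> Gamma (INR n + s) = poch s n * Gamma s.
Proof.
  intros Hs. induction n as [|n IH]; simpl poch.
  - simpl INR. rewrite Rplus_0_l; ring.
  - rewrite S_INR. replace (INR n + 1 + s) with (INR n + s + 1) by ring.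
    pose proof (pos_INR n). rewrite Gamma_succ, IH by lra. ring.
Qed.

(** Each quotient of factors is 1 + p/(s+k) <= exp (p/(k+1)), as s >= 1; the exponents add up to p
    times a harmonic number. *)
Lemma poch_add_le (s p : R) (n : nat) : 1 <= s -> 0 <= p ->
  poch (s + p) n <= exp (p * sum_n_m (fun k => / INR k) 1 n) * poch s n.
Proof.
  intros Hs Hp. induction n as [|n IH].
  - rewrite sum_n_m_zero by lia. unfold zero; simpl. rewrite Rmult_0_r, exp_0; lra.
  - rewrite sum_n_Sm by lia. unfold plus; simpl poch; simpl plus.
    pose proof (pos_INR n). pose proof (poch_pos s n ltac:(lra)).
    pose proof (poch_pos (s + p) n ltac:(lra)).
    rewrite (Rmult_plus_distr_l p), exp_plus.
    assert (s + p + INR n <= exp (p * / INR (S n)) * (s + INR n)).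
    { rewrite S_INR. pose proof (exp_ineq1_le (p * / (INR n + 1))) as H2.
      apply Rle_trans with ((1 + p * / (INR n + 1)) * (s + INR n)); [|apply Rmult_le_compat_r; lra].
      assert (0 <= p / (INR n + 1)) by (apply Rdiv_le_0_compat; lra).
      assert (p / (INR n + 1) * (INR n + 1) = p) by (field; lra). unfold Rdiv in *. nra. }
    match goal with |- _ <= ?E * ?F * (?G * ?K) =>
      replace (E * F * (G * K)) with ((E * G) * (F * K)) by ring end.
    apply Rmult_le_compat; lra.
Qed.

(** The value 17/25 is just large enough: 4 * 17/25 = 2.72 exceeds the harmonic number H_8 = 761/280
    = 2.7178... *)
Lemma ln_2_ge : 17 / 25 <= ln 2.
Proof.
  assert (Hsq : forall x q r, 0 <= q -> r <= q * q -> q <= exp (x / 2) -> r <= exp x).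
  { intros x q r Hq Hr H. replace x with (x / 2 + x / 2) by field. rewrite exp_plus. nra. }
  assert (H : / 2 <= exp (- (17 / 25))).
  (* The numbers are successive square roots of 1/2, rounded upwards. After five halvings the
     exponent is -17/800, where exp x >= 1 + x gives 783/800. *)
  { apply (Hsq _ (7087 / 10000)); [lra|lra|]. apply (Hsq _ (8419 / 10000)); [lra|lra|].
    apply (Hsq _ (9176 / 10000)); [lra|lra|]. apply (Hsq _ (95795 / 100000)); [lra|lra|].
    apply (Hsq _ (783 / 800)); [lra|lra|].
    eapply Rle_trans; [|apply exp_ineq1_le]. lra. }
  apply ln_le in H; [|lra]. rewrite ln_exp, ln_Rinv in H by lra. lra.
Qed.

(* Shift [s] by 8 before applying [Gamma_add_ge]: the harmonic number H_8 = 761/280 is at most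
   ln 16, whereas H_1 > ln 2. *)
Lemma Rpower_2_Gamma_mono (s p : R) : 1 <= s -> 0 <= p -> Gamma s <= Rpower 2 p * Gamma (s + p).
Proof.
  intros Hs Hp.
  pose proof (poch_add_le s p 8 Hs Hp) as H1.
  pose proof (Gamma_add_ge (s + 7) p ltac:(lra) Hp) as H2.
  replace (s + 7 + 1) with (INR 8 + s) in H2 by (simpl; ring).
  replace (INR 8 + s + p) with (INR 8 + (s + p)) in H2 by ring.
  rewrite !Gamma_add_INR in H2 by lra.
  pose proof (poch_pos s 8 ltac:(lra)) as Hq.
  pose proof (Gamma_pos s ltac:(lra)) as Hg. pose proof (Gamma_pos (s + p) ltac:(lra)) as Hg'.
  assert (H3 : exp (p * sum_n_m (fun k => / INR k) 1 8) <= Rpower 2 p * Rpower 8 p).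
  { rewrite Rpower_mult_distr by lra. unfold Rpower. apply exp_le, Rmult_le_compat_l; [lra|].
    replace (ln (2 * 8)) with (4 * ln 2).
    2:{ replace (2 * 8) with (2 * 2 * 2 * 2) by ring. rewrite !ln_mult by lra. ring. }
    pose proof ln_2_ge.
    repeat (rewrite sum_n_Sm by lia). rewrite sum_n_m_zero by lia.
    unfold plus, zero; simpl. lra. }
  assert (H4 : Rpower 8 p <= Rpower (s + 7) p) by (apply Rle_Rpower_l; lra).
  pose proof (Rpower_pos 8 p). pose proof (Rpower_pos 2 p).
  apply (Rmult_le_reg_l (Rpower 8 p * poch s 8)); [apply Rmult_lt_0_compat; assumption|].
  apply Rle_trans with (Rpower (s + 7) p * (poch s 8 * Gamma s)).
  - rewrite Rmult_assoc. apply Rmult_le_compat_r; [|assumption].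
    apply Rmult_le_pos; lra.
  - eapply Rle_trans; [exact H2|].
    replace (Rpower 8 p * poch s 8 * (Rpower 2 p * Gamma (s + p)))
      with (Rpower 2 p * Rpower 8 p * poch s 8 * Gamma (s + p)) by ring.
    apply Rmult_le_compat_r; [lra|]. eapply Rle_trans; [exact H1|].
    apply Rmult_le_compat_r; lra.
Qed.

(** * Everywhere convergent power series *)

Lemma CV_radius_infinite_of_le_fact (a : nat -> R) (C : R) :
  (forall n, Rabs (a n) <= C / INR (Factorial.fact n)) -> CV_radius a = p_infty.
Proof.
  intros H.
  assert (Hr : forall r, CV_disk a r).
  { intros r. unfold CV_disk.
    apply (ex_series_le (V := R_CompleteNormedModule) _
             (fun n => C * (/ INR (Factorial.fact n) * Rabs r ^ n))).
    - intros n. unfold norm; simpl. unfold abs; simpl.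
      rewrite Rabs_Rabsolu, Rabs_mult, <- RPow_abs, <- Rmult_assoc.
      apply Rmult_le_compat_r; [apply pow_le, Rabs_pos|apply H].
    - apply (ex_series_scal (V := R_NormedModule) C).
      exists (exp (Rabs r)). apply is_series_ext with (2 := is_exp_Reals (Rabs r)).
      intros n. unfold scal; simpl. unfold mult; simpl. rewrite pow_n_pow. ring. }
  unfold CV_radius. apply is_lub_Rbar_unique. split.
  - intros r _. exact I.
  - intros [b| |] Hb; simpl; auto.
    + specialize (Hb (b + 1) (Hr _)). simpl in Hb. lra.
    + exact (Hb 0 (Hr _)).
Qed.

Lemma PSeries_pos (a : nat -> R) (x : R) :
  CV_radius a = p_infty -> (forall n, 0 <= a n) -> 0 < a O -> 0 <= x -> 0 < PSeries a x.
Proof.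
  intros Ha Hn H0 Hx. apply Rlt_le_trans with (a O); [assumption|].
  assert (Hex : ex_series (fun n => a n * x ^ n)).
  { apply ex_pseries_R, CV_radius_inside. rewrite Ha. exact I. }
  unfold PSeries. rewrite Series_incr_1 by assumption.
  assert (0 <= Series (fun n => a (S n) * x ^ S n)); [|rewrite pow_O; lra].
  rewrite <- (Rmult_0_l (Series (fun n => a (S n) * x ^ S n))), <- Series_scal_l.
  apply Series_le; [|now apply (ex_series_incr_1 (fun n => a n * x ^ n))].
  intros n. pose proof (Hn (S n)). pose proof (pow_le x (S n) Hx). nra.
Qed.

(** * Kummer's function *)

Definition kummer_coeff (c b : R) (n : nat) : R :=
  poch c n / (poch b n * INR (Factorial.fact n)).

Definition kummer (c b : R) : R -> R := PSeries (kummer_coeff c b).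

Lemma poch_nonneg (c : R) (n : nat) : 0 <= c -> 0 <= poch c n.
Proof.
  intros Hc. induction n as [|n IH]; simpl; [lra|].
  pose proof (pos_INR n). apply Rmult_le_pos; lra.
Qed.

Lemma poch_le (c b : R) (n : nat) : 0 <= c -> c <= b -> poch c n <= poch b n.
Proof.
  intros Hc Hb. induction n as [|n IH]; simpl; [lra|].
  pose proof (pos_INR n). pose proof (poch_nonneg c n Hc).
  apply Rmult_le_compat; lra.
Qed.

Lemma CV_radius_kummer (c b : R) : 0 <= c -> 0 < b -> c <= b ->
  CV_radius (kummer_coeff c b) = p_infty.
Proof.
  intros Hc Hb Hcb. apply CV_radius_infinite_of_le_fact with 1. intros n.
  unfold kummer_coeff. pose proof (poch_nonneg c n Hc). pose proof (poch_pos b n Hb).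
  pose proof (poch_le c b n Hc Hcb). pose proof (INR_fact_lt_0 n).
  rewrite Rabs_right.
  2:{ apply Rle_ge, Rdiv_le_0_compat; [assumption|]. now apply Rmult_lt_0_compat. }
  apply Rmult_le_reg_r with (poch b n * INR (Factorial.fact n)); [now apply Rmult_lt_0_compat|].
  replace (poch c n / (poch b n * INR (Factorial.fact n)) * (poch b n * INR (Factorial.fact n)))
    with (poch c n) by (field; lra).
  replace (1 / INR (Factorial.fact n) * (poch b n * INR (Factorial.fact n)))
    with (poch b n) by (field; lra). assumption.
Qed.

Lemma kummer_coeff_nonneg (c b : R) (n : nat) : 0 <= c -> 0 < b -> 0 <= kummer_coeff c b n.
Proof.
  intros Hc Hb. apply Rdiv_le_0_compat; [now apply poch_nonneg|].
  apply Rmult_lt_0_compat; [now apply poch_pos|apply INR_fact_lt_0].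
Qed.

Lemma kummer_0 (c b : R) : kummer c b 0 = 1.
Proof. unfold kummer. rewrite PSeries_0. unfold kummer_coeff; simpl. field. Qed.

Lemma poch_shift (b : R) (n : nat) : poch b (S n) = b * poch (b + 1) n.
Proof.
  induction n as [|n IH]; [simpl; ring|].
  change (poch b (S n) * (b + INR (S n)) = b * (poch (b + 1) n * (b + 1 + INR n))).
  rewrite IH, S_INR. ring.
Qed.

Definition dkummer (c b : R) : R -> R := PSeries (PS_derive (kummer_coeff c b)).

Lemma is_derive_kummer (c b x : R) : 0 <= c -> 0 < b -> c <= b ->
  is_derive (kummer c b) x (dkummer c b x).
Proof.
  intros Hc Hb Hcb. apply is_derive_PSeries. rewrite CV_radius_kummer by assumption. exact I.
Qed.

Lemma ex_pseries_kummer (c b x : R) : 0 <= c -> 0 < b -> c <= b ->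
  ex_pseries (kummer_coeff c b) x.
Proof.
  intros Hc Hb Hcb. apply CV_radius_inside. rewrite CV_radius_kummer by assumption. exact I.
Qed.

Lemma kummer_pos (c b x : R) : 0 <= c -> 0 < b -> c <= b -> 0 <= x -> 0 < kummer c b x.
Proof.
  intros Hc Hb Hcb Hx. apply PSeries_pos; auto.
  - now apply CV_radius_kummer.
  - intros n. now apply kummer_coeff_nonneg.
  - unfold kummer_coeff; simpl. lra.
Qed.

Lemma kummer_coeff_succ (c b : R) (n : nat) : 0 < b ->
  INR (S n) * kummer_coeff c b (S n) = kummer_coeff c b n * (c + INR n) / (b + INR n).
Proof.
  intros Hb. unfold kummer_coeff. simpl poch. rewrite fact_simpl, mult_INR.
  pose proof (poch_pos b n Hb). pose proof (INR_fact_lt_0 n). pose proof (pos_INR n).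
  rewrite S_INR. field. lra.
Qed.

Lemma kummer_coeff_succ_top (c b : R) (n : nat) :
  c * kummer_coeff (c + 1) b n = (c + INR n) * kummer_coeff c b n.
Proof.
  unfold kummer_coeff. pose proof (poch_shift c n) as H. simpl in H.
  replace (c * (poch (c + 1) n / (poch b n * INR (Factorial.fact n))))
    with ((c * poch (c + 1) n) / (poch b n * INR (Factorial.fact n))) by (unfold Rdiv; ring).
  rewrite <- H. unfold Rdiv; ring.
Qed.

Lemma kummer_coeff_succ_bot (c b : R) (n : nat) : 0 < b ->
  kummer_coeff c b n = (b + INR n) / b * kummer_coeff c (b + 1) n.
Proof.
  intros Hb. unfold kummer_coeff. pose proof (poch_shift b n) as H. simpl in H.
  pose proof (poch_pos (b + 1) n ltac:(lra)). pose proof (poch_pos b n ltac:(lra)).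
  pose proof (INR_fact_lt_0 n). pose proof (pos_INR n).
  replace (poch b n) with (b * poch (b + 1) n / (b + INR n)) by (rewrite <- H; field; lra).
  field. lra.
Qed.

Lemma kummer_le_top (c b x : R) : 0 <= c -> 0 < b -> c + 1 <= b -> 0 <= x ->
  kummer c b x <= kummer (c + 1) b x.
Proof.
  intros Hc Hb Hcb Hx. apply Series_le.
  - intros n. pose proof (pow_le x n Hx). pose proof (kummer_coeff_nonneg c b n Hc Hb). split; [nra|].
    apply Rmult_le_compat_r; [assumption|]. unfold kummer_coeff.
    apply Rmult_le_compat_r; [|apply poch_le; lra].
    left. apply Rinv_0_lt_compat, Rmult_lt_0_compat; [now apply poch_pos|apply INR_fact_lt_0].
  - apply ex_pseries_R, ex_pseries_kummer; lra.
Qed.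

(** Differentiation multiplies the n-th coefficient by (c+n)/(b+n) = 1 - (b-c)/(b+n), and the
    denominator b+n is absorbed by raising b to b+1. *)
Lemma dkummer_minus (c b x : R) : 0 <= c -> 0 < b -> c <= b ->
  dkummer c b x = kummer c b x - (b - c) / b * kummer c (b + 1) x.
Proof.
  intros Hc Hb Hcb. unfold dkummer, kummer, Rminus. rewrite Ropp_mult_distr_l.
  rewrite <- PSeries_scal, <- PSeries_plus.
  - apply PSeries_ext. intros n. change (PS_derive (kummer_coeff c b) n =
      kummer_coeff c b n + - ((b - c) / b) * kummer_coeff c (b + 1) n).
    unfold PS_derive. rewrite kummer_coeff_succ, kummer_coeff_succ_bot by assumption.
    pose proof (pos_INR n). field. lra.
  - now apply ex_pseries_kummer.
  - apply ex_pseries_scal; [apply Rmult_comm|]. apply ex_pseries_kummer; lra.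
Qed.

(** The operator x d/dx multiplies the n-th coefficient by n = (c+n) - c, and c+n raises the upper
    parameter. *)
Lemma dkummer_up (c b x : R) : 0 <= c -> 0 < b -> c + 1 <= b ->
  x * dkummer c b x = c * (kummer (c + 1) b x - kummer c b x).
Proof.
  intros Hc Hb Hcb. unfold dkummer, kummer.
  replace (c * (PSeries (kummer_coeff (c + 1) b) x - PSeries (kummer_coeff c b) x))
    with (c * PSeries (kummer_coeff (c + 1) b) x + - c * PSeries (kummer_coeff c b) x) by ring.
  rewrite <- PSeries_incr_1, <- !PSeries_scal, <- PSeries_plus.
  - apply PSeries_ext. intros n. change (PS_incr_1 (PS_derive (kummer_coeff c b)) n =
      c * kummer_coeff (c + 1) b n + - c * kummer_coeff c b n).
    rewrite kummer_coeff_succ_top. destruct n as [|n].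
    + simpl. unfold zero; simpl. ring.
    + change (INR (S n) * kummer_coeff c b (S n) =
        (c + INR (S n)) * kummer_coeff c b (S n) + - c * kummer_coeff c b (S n)). ring.
  - apply ex_pseries_scal; [apply Rmult_comm|]. apply ex_pseries_kummer; lra.
  - apply ex_pseries_scal; [apply Rmult_comm|]. apply ex_pseries_kummer; lra.
Qed.

Lemma dkummer_down (c b x : R) : 0 <= c -> 0 < b -> c + 1 <= b ->
  x * dkummer (c + 1) b x = (b - c - 1) * kummer c b x + (c + 1 - b + x) * kummer (c + 1) b x.
Proof.
  intros Hc Hb Hcb. unfold dkummer, kummer. rewrite Rmult_plus_distr_r, <- Rplus_assoc.
  rewrite <- !PSeries_incr_1, <- !PSeries_scal, <- !PSeries_plus.
  - apply PSeries_ext. intros [|n].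
    + change (0 = (b - c - 1) * kummer_coeff c b 0 + (c + 1 - b) * kummer_coeff (c + 1) b 0 + 0).
      unfold kummer_coeff; simpl. field.
    + change (INR (S n) * kummer_coeff (c + 1) b (S n) =
        (b - c - 1) * kummer_coeff c b (S n) + (c + 1 - b) * kummer_coeff (c + 1) b (S n)
        + kummer_coeff (c + 1) b n).
      pose proof (kummer_coeff_succ (c + 1) b n Hb) as H1.
      pose proof (kummer_coeff_succ_top c b (S n)) as H2.
      pose proof (pos_INR n).
      (* Everything is expressed through one coefficient of the function with upper parameter c+1.
         Dividing by c + n + 1 and never by c keeps the case c = 0, that is nu = -1/2. *)
      replace (kummer_coeff c b (S n)) with (c * kummer_coeff (c + 1) b (S n) / (c + INR (S n))).
      2:{ rewrite H2. field. rewrite S_INR. lra. }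
      replace (kummer_coeff (c + 1) b n)
        with (INR (S n) * kummer_coeff (c + 1) b (S n) * (b + INR n) / (c + 1 + INR n)).
      2:{ rewrite H1. field. lra. }
      rewrite S_INR. field. lra.
  - apply ex_pseries_plus; (apply ex_pseries_scal; [apply Rmult_comm|]); apply ex_pseries_kummer; lra.
  - apply ex_pseries_incr_1. apply ex_pseries_kummer; lra.
  - apply ex_pseries_scal; [apply Rmult_comm|]; apply ex_pseries_kummer; lra.
  - apply ex_pseries_scal; [apply Rmult_comm|]; apply ex_pseries_kummer; lra.
Qed.

(** * Modified Bessel functions *)

Definition bessel_coeff (mu : R) (n : nat) : R := / (INR (Factorial.fact n) * poch mu n).

(* The hypergeometric function 0F1(; mu; x). *)
Definition bessel_series (mu : R) : R -> R := PSeries (bessel_coeff mu).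

Lemma CV_radius_bessel_coeff (mu : R) : 0 < mu -> CV_radius (bessel_coeff mu) = p_infty.
Proof.
  intros Hmu. apply CV_radius_infinite_of_le_fact with (1 + / mu). intros n.
  unfold bessel_coeff. pose proof (poch_pos mu n Hmu). pose proof (INR_fact_lt_0 n).
  rewrite Rabs_right by (apply Rle_ge; left; apply Rinv_0_lt_compat, Rmult_lt_0_compat; lra).
  rewrite Rinv_mult, Rmult_comm. apply Rmult_le_compat_r; [left; now apply Rinv_0_lt_compat|].
  pose proof (Rinv_0_lt_compat mu Hmu).
  destruct n as [|n]; [simpl; lra|]. rewrite poch_shift, Rinv_mult.
  assert (Hp : 1 <= poch (mu + 1) n).
  { clear -Hmu. induction n as [|n IH]; simpl; [lra|]. pose proof (pos_INR n). nra. }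
  assert (/ poch (mu + 1) n <= 1) by (apply Rle_trans with (/ 1); [apply Rinv_le_contravar|]; lra).
  nra.
Qed.

Lemma bessel_series_0 (mu : R) : bessel_series mu 0 = 1.
Proof. unfold bessel_series. rewrite PSeries_0. unfold bessel_coeff; simpl. field. Qed.

Lemma is_derive_bessel_series (mu x : R) : 0 < mu ->
  is_derive (bessel_series mu) x (bessel_series (mu + 1) x / mu).
Proof.
  intros Hmu. unfold Rdiv. rewrite Rmult_comm. unfold bessel_series. rewrite <- PSeries_scal.
  replace (PSeries (PS_scal (/ mu) (bessel_coeff (mu + 1))) x)
    with (PSeries (PS_derive (bessel_coeff mu)) x).
  - apply is_derive_PSeries. rewrite CV_radius_bessel_coeff by assumption. exact I.
  - apply PSeries_ext. intros n.
    change (INR (S n) * bessel_coeff mu (S n) = / mu * bessel_coeff (mu + 1) n).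
    unfold bessel_coeff. rewrite poch_shift, fact_simpl, mult_INR.
    pose proof (poch_pos (mu + 1) n ltac:(lra)). pose proof (INR_fact_lt_0 n). pose proof (pos_INR n).
    field. rewrite S_INR. repeat split; lra.
Qed.

(** At the argument (x/2)^2 this is the three-term recurrence I_(mu-1) - I_(mu+1) = (2 mu/x) I_mu,
    stripped of its powers of x/2. *)
Lemma bessel_series_contiguous (mu x : R) : 0 < mu ->
  bessel_series mu x =
  bessel_series (mu + 1) x + x * (bessel_series (mu + 1 + 1) x / (mu * (mu + 1))).
Proof.
  intros Hmu.
  replace (x * (bessel_series (mu + 1 + 1) x / (mu * (mu + 1))))
    with (/ (mu * (mu + 1)) * (x * bessel_series (mu + 1 + 1) x)) by (unfold Rdiv; ring).
  unfold bessel_series.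
  rewrite <- PSeries_incr_1, <- PSeries_scal, <- PSeries_plus.
  - apply PSeries_ext. intros [|n].
    + change (bessel_coeff mu 0 = bessel_coeff (mu + 1) 0 + / (mu * (mu + 1)) * 0).
      unfold bessel_coeff; simpl. ring.
    + change (bessel_coeff mu (S n) = bessel_coeff (mu + 1) (S n)
        + / (mu * (mu + 1)) * bessel_coeff (mu + 1 + 1) n).
      unfold bessel_coeff. rewrite (poch_shift mu). simpl poch. rewrite fact_simpl, mult_INR.
      pose proof (poch_shift (mu + 1) n) as H. simpl in H.
      pose proof (poch_pos (mu + 1) n ltac:(lra)). pose proof (poch_pos (mu + 1 + 1) n ltac:(lra)).
      pose proof (INR_fact_lt_0 n). pose proof (pos_INR n).
      replace (poch (mu + 1 + 1) n) with (poch (mu + 1) n * (mu + 1 + INR n) / (mu + 1))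
        by (rewrite H; field; lra).
      rewrite S_INR. field. repeat split; lra.
  - apply CV_radius_inside. rewrite CV_radius_bessel_coeff by lra. exact I.
  - apply ex_pseries_scal; [apply Rmult_comm|]. apply ex_pseries_incr_1, CV_radius_inside.
    rewrite CV_radius_bessel_coeff by lra. exact I.
Qed.

Lemma Rpower_add_even (y nu : R) (k : nat) : 0 < y ->
  Rpower y (2 * INR k + nu) = Rpower y nu * (y ^ 2) ^ k.
Proof.
  intros Hy. rewrite Rpower_plus, <- Rpower_mult, Rpower_pow by apply Rpower_pos.
  replace (Rpower y 2) with (y ^ 2); [ring|].
  rewrite <- Rpower_pow by assumption. f_equal; simpl; ring.
Qed.

Definition bessel_term (nu x : R) (k : nat) : R :=
  Rpower (x / 2) (2 * INR k + nu) / (INR (Factorial.fact k) * Gamma (INR k + nu + 1)).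

Lemma bessel_term_eq (nu x : R) (k : nat) : -1 < nu -> 0 < x ->
  bessel_term nu x k =
  Rpower (x / 2) nu / Gamma (nu + 1) * (bessel_coeff (nu + 1) k * ((x / 2) ^ 2) ^ k).
Proof.
  intros Hnu Hx. unfold bessel_term, bessel_coeff.
  rewrite Rplus_assoc, Gamma_add_INR, Rpower_add_even by lra.
  pose proof (Gamma_pos (nu + 1) ltac:(lra)). pose proof (poch_pos (nu + 1) k ltac:(lra)).
  pose proof (INR_fact_lt_0 k). field. lra.
Qed.

Lemma ex_series_bessel_term (nu x : R) : -1 < nu -> 0 < x -> ex_series (bessel_term nu x).
Proof.
  intros Hnu Hx.
  apply ex_series_ext with (fun k => Rpower (x / 2) nu / Gamma (nu + 1) *
    (bessel_coeff (nu + 1) k * ((x / 2) ^ 2) ^ k)).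
  - intros k. symmetry. now apply bessel_term_eq.
  - apply (ex_series_scal (V := R_NormedModule)). apply ex_pseries_R, CV_radius_inside.
    rewrite CV_radius_bessel_coeff by lra. exact I.
Qed.

Lemma BesselI_eq (nu x : R) : -1 < nu -> 0 < x ->
  BesselI nu x = Rpower (x / 2) nu / Gamma (nu + 1) * bessel_series (nu + 1) ((x / 2) ^ 2).
Proof.
  intros Hnu Hx. unfold bessel_series, PSeries. rewrite <- Series_scal_l.
  apply Series_ext. intros k. now apply bessel_term_eq.
Qed.

(* [x^-nu I_nu x] and [x^-nu I_(nu+1) x], normalised by the value of the former at 0. *)
Definition bessel_even (nu x : R) : R := bessel_series (nu + 1) ((x / 2) ^ 2).
Definition bessel_odd (nu x : R) : R :=
  x / 2 * (bessel_series (nu + 1 + 1) ((x / 2) ^ 2) / (nu + 1)).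

Lemma BesselI_eq_even (nu x : R) : -1 < nu -> 0 < x ->
  BesselI nu x = Rpower (x / 2) nu / Gamma (nu + 1) * bessel_even nu x.
Proof. apply BesselI_eq. Qed.

Lemma BesselI_succ_eq_odd (nu x : R) : -1 < nu -> 0 < x ->
  BesselI (nu + 1) x = Rpower (x / 2) nu / Gamma (nu + 1) * bessel_odd nu x.
Proof.
  intros Hnu Hx. rewrite BesselI_eq by lra. unfold bessel_odd.
  rewrite Rpower_plus, Rpower_1, (Gamma_succ (nu + 1)) by lra.
  pose proof (Gamma_pos (nu + 1) ltac:(lra)). field. lra.
Qed.

Lemma is_derive_bessel_even (nu x : R) : -1 < nu ->
  is_derive (bessel_even nu) x (bessel_odd nu x).
Proof.
  intros Hnu. unfold bessel_even, bessel_odd.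
  evar_last.
  - apply (is_derive_comp (bessel_series (nu + 1)) (fun x => (x / 2) ^ 2)).
    + apply is_derive_bessel_series; lra.
    + auto_derive; [trivial|reflexivity].
  - unfold scal; simpl; unfold mult; simpl. field. lra.
Qed.

Lemma is_derive_bessel_odd (nu x : R) : -1 < nu -> 0 < x ->
  is_derive (bessel_odd nu) x (bessel_even nu x - (2 * nu + 1) / x * bessel_odd nu x).
Proof.
  intros Hnu Hx. unfold bessel_odd at 1.
  evar_last.
  - apply (is_derive_mult (fun x => x / 2)
      (fun x => bessel_series (nu + 1 + 1) ((x / 2) ^ 2) / (nu + 1))); [| |exact Rmult_comm].
    + auto_derive; [trivial|reflexivity].
    + unfold Rdiv. apply (is_derive_scal_l (V := R_NormedModule)).
      apply (is_derive_comp (bessel_series (nu + 1 + 1)) (fun x => (x / 2) ^ 2)).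
      * apply is_derive_bessel_series; lra.
      * auto_derive; [trivial|reflexivity].
  - unfold bessel_even, bessel_odd. rewrite (bessel_series_contiguous (nu + 1)) by lra.
    unfold plus, mult, scal; simpl; unfold mult; simpl. field. lra.
Qed.

(* For nu = a - 1/2, [Phi0 nu * kummer_g a x] and [Phi0 nu * kummer_h a x] turn out to be
   e^-x x^-nu (I_nu x + I_(nu+1) x) and e^-x x^-nu (I_nu x - I_(nu+1) x). *)
Definition kummer_g (a x : R) : R := exp (- (2 * x)) * kummer (a + 1) (2 * a + 1) (2 * x).
Definition kummer_h (a x : R) : R := exp (- (2 * x)) * kummer a (2 * a + 1) (2 * x).

Lemma kummer_g_0 (a : R) : kummer_g a 0 = 1.
Proof. unfold kummer_g. rewrite Rmult_0_r, Ropp_0, exp_0, kummer_0. ring. Qed.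

Lemma kummer_h_0 (a : R) : kummer_h a 0 = 1.
Proof. unfold kummer_h. rewrite Rmult_0_r, Ropp_0, exp_0, kummer_0. ring. Qed.

Lemma kummer_g_pos (a x : R) : 0 <= a -> 0 <= x -> 0 < kummer_g a x.
Proof.
  intros Ha Hx. apply Rmult_lt_0_compat; [apply exp_pos|]. apply kummer_pos; lra.
Qed.

Lemma kummer_h_pos (a x : R) : 0 <= a -> 0 <= x -> 0 < kummer_h a x.
Proof.
  intros Ha Hx. apply Rmult_lt_0_compat; [apply exp_pos|]. apply kummer_pos; lra.
Qed.

Lemma kummer_h_le_g (a x : R) : 0 <= a -> 0 <= x -> kummer_h a x <= kummer_g a x.
Proof.
  intros Ha Hx. apply Rmult_le_compat_l; [left; apply exp_pos|]. apply kummer_le_top; lra.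
Qed.

Lemma is_derive_exp_kummer (c b x : R) : 0 <= c -> 0 < b -> c <= b ->
  is_derive (fun x => exp (- (2 * x)) * kummer c b (2 * x)) x
    (2 * exp (- (2 * x)) * (dkummer c b (2 * x) - kummer c b (2 * x))).
Proof.
  intros Hc Hb Hcb. evar_last.
  - apply (is_derive_mult (fun x => exp (- (2 * x))) (fun x => kummer c b (2 * x))); [| |exact Rmult_comm].
    + auto_derive; [trivial|reflexivity].
    + apply (is_derive_comp (kummer c b) (fun x => 2 * x)).
      * now apply is_derive_kummer.
      * auto_derive; [trivial|reflexivity].
  - unfold plus, mult, scal; simpl; unfold mult; simpl. ring.
Qed.

Lemma is_derive_kummer_g (a x : R) : 0 <= a -> 0 < x ->
  is_derive (kummer_g a) x (a * (kummer_h a x - kummer_g a x) / x).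
Proof.
  intros Ha Hx. unfold kummer_g at 1. evar_last.
  - apply is_derive_exp_kummer; lra.
  - pose proof (dkummer_down a (2 * a + 1) (2 * x) Ha ltac:(lra) ltac:(lra)) as H.
    unfold kummer_g, kummer_h.
    replace (dkummer (a + 1) (2 * a + 1) (2 * x))
      with ((2 * x) * dkummer (a + 1) (2 * a + 1) (2 * x) / (2 * x)) by (field; lra).
    rewrite H. field. lra.
Qed.

Lemma is_derive_kummer_h (a x : R) : 0 <= a -> 0 < x ->
  is_derive (kummer_h a) x (a * (kummer_g a x - kummer_h a x) / x - 2 * kummer_h a x).
Proof.
  intros Ha Hx. unfold kummer_h at 1. evar_last.
  - apply is_derive_exp_kummer; lra.
  - pose proof (dkummer_up a (2 * a + 1) (2 * x) Ha ltac:(lra) ltac:(lra)) as H.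
    unfold kummer_g, kummer_h.
    replace (dkummer a (2 * a + 1) (2 * x))
      with ((2 * x) * dkummer a (2 * a + 1) (2 * x) / (2 * x)) by (field; lra).
    rewrite H. field. lra.
Qed.

Lemma continuous_kummer_g (a x : R) : 0 <= a -> continuous (kummer_g a) x.
Proof.
  intros Ha. apply (ex_derive_continuous (V := R_NormedModule)). eexists.
  apply is_derive_exp_kummer; lra.
Qed.

Lemma continuous_kummer_h (a x : R) : 0 <= a -> continuous (kummer_h a) x.
Proof.
  intros Ha. apply (ex_derive_continuous (V := R_NormedModule)). eexists.
  apply is_derive_exp_kummer; lra.
Qed.

(** * Continuity, and signs obtained from derivatives and data at 0 *)

Lemma continuous_Rmult (f g : R -> R) (x : R) :
  continuous f x -> continuous g x -> continuous (fun t => f t * g t) x.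
Proof. apply (continuous_mult (K := R_AbsRing)). Qed.

Lemma continuous_Rplus (f g : R -> R) (x : R) :
  continuous f x -> continuous g x -> continuous (fun t => f t + g t) x.
Proof. apply (continuous_plus (V := R_NormedModule)). Qed.

Lemma continuous_Rminus (f g : R -> R) (x : R) :
  continuous f x -> continuous g x -> continuous (fun t => f t - g t) x.
Proof. apply (continuous_minus (V := R_NormedModule)). Qed.

Lemma MVT_is_derive (F F' : R -> R) (x y : R) :
  x <= y -> (forall t, x <= t <= y -> is_derive F t (F' t)) ->
  exists c, x <= c <= y /\ F y - F x = F' c * (y - x).
Proof.
  intros Hxy Hd. destruct (MVT_gen F x y F') as (c & Hc & E);
    rewrite ?Rmin_left, ?Rmax_right in * by assumption.
  - intros t Ht. apply Hd; lra.
  - intros t Ht. apply continuity_pt_filterlim. apply (ex_derive_continuous (V := R_NormedModule)).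
    eexists. apply Hd; lra.
  - now exists c.
Qed.

Lemma nonincreasing_of_derive (F F' : R -> R) (x y : R) :
  x <= y -> (forall t, x <= t <= y -> is_derive F t (F' t)) ->
  (forall t, x <= t <= y -> F' t <= 0) -> F y <= F x.
Proof.
  intros Hxy Hd Hn. destruct (MVT_is_derive F F' x y Hxy Hd) as (c & Hc & E).
  specialize (Hn c Hc). nra.
Qed.

(** F itself need not be continuous at 0, where a factor [Rpower x (2 * a)] only has a default
    value. The initial value is therefore carried by a majorant phi that is continuous there: a
    positive F x would persist to the left of x, against the smallness of phi. *)
Lemma nonpos_of_derive_nonpos (F F' phi : R -> R) :
  (forall x, 0 < x -> is_derive F x (F' x)) -> (forall x, 0 < x -> F' x <= 0) ->
  (forall x, 0 < x -> x < 1 -> Rabs (F x) <= Rabs (phi x)) ->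
  continuous phi 0 -> phi 0 = 0 -> forall x, 0 < x -> F x <= 0.
Proof.
  intros Hd Hn Hb Hc H0 x Hx. apply Rnot_lt_le. intros Hpos.
  destruct (proj1 (filterlim_locally phi (phi 0)) Hc (mkposreal _ Hpos)) as [d Hd'].
  set (t := Rmin (Rmin (d / 2) (/ 2)) x).
  assert (Ht : 0 < t /\ t <= d / 2 /\ t <= / 2 /\ t <= x).
  { unfold t. destruct d as [d Hdp]; simpl. repeat split.
    - repeat apply Rmin_pos; lra.
    - eapply Rle_trans; [apply Rmin_l|apply Rmin_l].
    - eapply Rle_trans; [apply Rmin_l|apply Rmin_r].
    - apply Rmin_r. }
  destruct d as [d Hdp]; simpl in *.
  assert (Hball : Rabs (phi t) < F x).
  { specialize (Hd' t). unfold ball in Hd'; simpl in Hd'. unfold AbsRing_ball, abs, minus, plus, opp in Hd'.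
    simpl in Hd'. rewrite H0, Ropp_0, !Rplus_0_r in Hd'. apply Hd'. rewrite Rabs_right; lra. }
  assert (F x <= F t).
  { apply (nonincreasing_of_derive F F'); [lra|intros; apply Hd; lra|intros; apply Hn; lra]. }
  pose proof (Hb t ltac:(lra) ltac:(lra)). pose proof (Rle_abs (F t)). lra.
Qed.

Lemma continuous_exp_mul (k x : R) : continuous (fun x => exp (k * x)) x.
Proof.
  apply (ex_derive_continuous (V := R_NormedModule)). auto_derive. trivial.
Qed.

Ltac eta_Derive :=
  repeat match goal with |- context [Derive (fun x => ?f x) ?y] =>
    change (Derive (fun x => f x) y) with (Derive f y) end.

(* Both pairs solve A' = B, B' = A - (2a/x) B with the same values at 0, and for the difference
   of two solutions e^(-2x) (A^2 + B^2) is nonincreasing. *)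
Lemma bessel_even_odd_eq_kummer (nu x : R) : -1/2 <= nu -> 0 < x ->
  bessel_even nu x = exp x * (kummer_g (nu + 1/2) x + kummer_h (nu + 1/2) x) / 2 /\
  bessel_odd nu x = exp x * (kummer_g (nu + 1/2) x - kummer_h (nu + 1/2) x) / 2.
Proof.
  intros Hnu Hx0. set (a := nu + 1/2). assert (Ha : 0 <= a) by (unfold a; lra).
  set (u := fun x => bessel_even nu x - exp x * (kummer_g a x + kummer_h a x) / 2).
  set (v := fun x => bessel_odd nu x - exp x * (kummer_g a x - kummer_h a x) / 2).
  assert (Hu : forall x, 0 < x -> is_derive u x (v x)).
  { intros t Ht. unfold u, v.
    pose proof (is_derive_bessel_even nu t ltac:(lra)) as H1.
    pose proof (is_derive_kummer_g a t Ha Ht) as H2. pose proof (is_derive_kummer_h a t Ha Ht) as H3.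
    auto_derive; [repeat split; eexists; eassumption|].
    eta_Derive. rewrite (is_derive_unique _ _ _ H1), (is_derive_unique _ _ _ H2), (is_derive_unique _ _ _ H3).
    field. lra. }
  assert (Hv : forall x, 0 < x -> is_derive v x (u x - 2 * a / x * v x)).
  { intros t Ht. unfold u, v.
    pose proof (is_derive_bessel_odd nu t ltac:(lra) Ht) as H1.
    pose proof (is_derive_kummer_g a t Ha Ht) as H2. pose proof (is_derive_kummer_h a t Ha Ht) as H3.
    auto_derive; [repeat split; eexists; eassumption|].
    eta_Derive. rewrite (is_derive_unique _ _ _ H1), (is_derive_unique _ _ _ H2), (is_derive_unique _ _ _ H3).
    unfold a. field. lra. }
  (* Since (u^2 + v^2)' = 4 u v - (4a/x) v^2, the term -2 (u^2 + v^2) from the exponential completes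
     the square -2 (u - v)^2. *)
  set (F := fun x => exp (-2 * x) * (u x * u x + v x * v x)).
  assert (HF : forall x, 0 < x -> F x <= 0).
  { apply nonpos_of_derive_nonpos with (phi := F)
      (F' := fun x => - exp (-2 * x) * (2 * (u x - v x) * (u x - v x) + 4 * a / x * (v x * v x))).
    - intros t Ht. unfold F. pose proof (Hu t Ht) as H1. pose proof (Hv t Ht) as H2.
      auto_derive; [repeat split; eexists; eassumption|].
      change (fun x => u x) with u. change (fun x => v x) with v.
      eta_Derive. rewrite (is_derive_unique _ _ _ H1), (is_derive_unique _ _ _ H2). field. lra.
    - intros t Ht. pose proof (exp_pos (-2 * t)).
      assert (0 <= 4 * a / t) by (apply Rdiv_le_0_compat; lra).
      assert (0 <= 2 * (u t - v t) * (u t - v t) + 4 * a / t * (v t * v t)); [|nra].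
      pose proof (Rle_0_sqr (u t - v t)). pose proof (Rle_0_sqr (v t)). unfold Rsqr in *.
      apply Rplus_le_le_0_compat; [lra|]. now apply Rmult_le_pos.
    - intros; lra.
    - assert (Hcu : continuous u 0).
      { unfold u. apply continuous_Rminus.
        - apply (ex_derive_continuous (V := R_NormedModule)). eexists. apply is_derive_bessel_even; lra.
        - apply continuous_Rmult; [|apply continuous_const]. apply continuous_Rmult; [apply continuous_exp|].
          apply continuous_Rplus; [now apply continuous_kummer_g|now apply continuous_kummer_h]. }
      assert (Hcv : continuous v 0).
      { unfold v. apply continuous_Rminus.
        - unfold bessel_odd. apply continuous_Rmult.
          + apply (ex_derive_continuous (V := R_NormedModule)). auto_derive. trivial.
          + apply continuous_Rmult; [|apply continuous_const].
            apply (continuous_comp (fun x => (x / 2) ^ 2)).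
            * apply (ex_derive_continuous (V := R_NormedModule)). auto_derive. trivial.
            * apply (ex_derive_continuous (V := R_NormedModule)). eexists.
              apply is_derive_bessel_series; lra.
        - apply continuous_Rmult; [|apply continuous_const]. apply continuous_Rmult; [apply continuous_exp|].
          apply continuous_Rminus; [now apply continuous_kummer_g|now apply continuous_kummer_h]. }
      unfold F. apply continuous_Rmult; [apply continuous_exp_mul|].
      apply continuous_Rplus; now apply continuous_Rmult.
    - unfold F, u, v, bessel_even, bessel_odd. rewrite kummer_g_0, kummer_h_0, exp_0.
      replace ((0 / 2) ^ 2) with 0 by field. rewrite bessel_series_0. field. lra. }
  specialize (HF x Hx0). unfold F in HF. pose proof (exp_pos (-2 * x)).
  assert (u x * u x + v x * v x <= 0).
  { apply Rmult_le_reg_l with (exp (-2 * x)); lra. }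
  assert (u x = 0) by nra. assert (v x = 0) by nra. unfold u, v in *. lra.
Qed.

(** The constant K of the overview; as [kummer_g] is 1 at 0, it is the limit of [Phi nu] at 0. *)
Definition Phi0 (nu : R) : R := Rpower 2 (- nu) / Gamma (nu + 1).

Lemma Phi0_pos (nu : R) : -1 < nu -> 0 < Phi0 nu.
Proof.
  intros H. apply Rdiv_lt_0_compat; [apply Rpower_pos|apply Gamma_pos; lra].
Qed.

Lemma Phi_eq_kummer (nu x : R) : -1/2 <= nu -> 0 < x ->
  Phi nu x = Phi0 nu * kummer_g (nu + 1/2) x.
Proof.
  intros Hnu Hx. unfold Phi. rewrite BesselI_eq_even, BesselI_succ_eq_odd by lra.
  destruct (bessel_even_odd_eq_kummer nu x Hnu Hx) as [-> ->].
  unfold Phi0. rewrite Rpower_Rdiv, !Rpower_Ropp, exp_Ropp by lra.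
  pose proof (Rpower_pos x nu). pose proof (Rpower_pos 2 nu). pose proof (exp_pos x).
  pose proof (Gamma_pos (nu + 1) ltac:(lra)). field. lra.
Qed.

Lemma BesselI_sub_eq (nu x : R) : -1/2 <= nu -> 0 < x ->
  exp (- x) * Rpower x (- nu) * (BesselI nu x - BesselI (nu + 1) x) =
  Phi0 nu * kummer_h (nu + 1/2) x.
Proof.
  intros Hnu Hx. rewrite BesselI_eq_even, BesselI_succ_eq_odd by lra.
  destruct (bessel_even_odd_eq_kummer nu x Hnu Hx) as [-> ->].
  unfold Phi0. rewrite Rpower_Rdiv, !Rpower_Ropp, exp_Ropp by lra.
  pose proof (Rpower_pos x nu). pose proof (Rpower_pos 2 nu). pose proof (exp_pos x).
  pose proof (Gamma_pos (nu + 1) ltac:(lra)). field. lra.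
Qed.

(** * Convexity and monotonicity in x *)

Lemma Rabs_Rpower_mul_le (x a r : R) : 0 <= a -> 0 < x -> x < 1 -> Rabs (Rpower x a * r) <= Rabs r.
Proof.
  intros Ha Hx Hx1. rewrite Rabs_mult, (Rabs_right (Rpower x a)) by (apply Rle_ge; left; apply Rpower_pos).
  rewrite <- (Rmult_1_l (Rabs r)) at 2. apply Rmult_le_compat_r; [apply Rabs_pos|].
  unfold Rpower. apply Rle_trans with (exp 0); [apply exp_le|rewrite exp_0; lra].
  pose proof (ln_increasing x 1 Hx Hx1) as H. rewrite ln_1 in H. nra.
Qed.

(** The D of the overview. It arises as (x g'/g)' = a D / (x g^2), where x g'/g is the derivative of
    ln g with respect to ln x. *)
Definition turan_geo (a x : R) : R :=
  a * (kummer_g a x * kummer_g a x - kummer_h a x * kummer_h a x)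
  - 2 * x * kummer_g a x * kummer_h a x.

(** The E of the overview, from (ln g)'' = - a E / (x^2 g^2). *)
Definition turan_log (a x : R) : R :=
  - turan_geo a x - kummer_g a x * (kummer_g a x - kummer_h a x).

Lemma is_derive_turan_geo (a x : R) : 0 <= a -> 0 < x ->
  is_derive (turan_geo a) x
    (- (2 * a / x + 2) * turan_geo a x - 2 * kummer_g a x * kummer_h a x).
Proof.
  intros Ha Hx. unfold turan_geo.
  pose proof (is_derive_kummer_g a x Ha Hx) as H1. pose proof (is_derive_kummer_h a x Ha Hx) as H2.
  auto_derive; [repeat split; eexists; eassumption|].
  eta_Derive. rewrite (is_derive_unique _ _ _ H1), (is_derive_unique _ _ _ H2). field. lra.
Qed.

Lemma is_derive_turan_log (a x : R) : 0 <= a -> 0 < x ->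
  is_derive (turan_log a) x
    (- (2 * a / x + 2) * turan_log a x +
     (kummer_g a x - kummer_h a x) * (a * (kummer_g a x - kummer_h a x) / x - 2 * kummer_g a x)).
Proof.
  intros Ha Hx. unfold turan_log.
  pose proof (is_derive_kummer_g a x Ha Hx) as H1. pose proof (is_derive_kummer_h a x Ha Hx) as H2.
  pose proof (is_derive_turan_geo a x Ha Hx) as H3.
  auto_derive; [repeat split; eexists; eassumption|].
  eta_Derive. rewrite (is_derive_unique _ _ _ H1), (is_derive_unique _ _ _ H2), (is_derive_unique _ _ _ H3).
  unfold turan_geo. field. lra.
Qed.

Lemma is_derive_integrating_factor (a x d : R) (f : R -> R) : 0 < x -> is_derive f x d ->
  is_derive (fun x => Rpower x (2 * a) * (exp (2 * x) * f x)) x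
    (Rpower x (2 * a) * exp (2 * x) * ((2 * a / x + 2) * f x + d)).
Proof.
  intros Hx H. unfold Rpower. auto_derive; [repeat split; [assumption|eexists; eassumption]|].
  eta_Derive. rewrite (is_derive_unique _ _ _ H). field. lra.
Qed.

Lemma nonpos_of_integrating_factor (a : R) (f r : R -> R) : 0 <= a ->
  (forall x, 0 < x -> is_derive f x (- (2 * a / x + 2) * f x + r x)) ->
  (forall x, 0 < x -> r x <= 0) -> continuous f 0 -> f 0 = 0 -> forall x, 0 < x -> f x <= 0.
Proof.
  intros Ha Hd Hr Hc H0 x Hx.
  assert (H : Rpower x (2 * a) * (exp (2 * x) * f x) <= 0).
  { apply (nonpos_of_derive_nonpos (fun x => Rpower x (2 * a) * (exp (2 * x) * f x))
      (fun x => Rpower x (2 * a) * exp (2 * x) * r x) (fun x => exp (2 * x) * f x)); auto.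
    - intros t Ht. pose proof (is_derive_integrating_factor a t _ f Ht (Hd t Ht)) as H.
      replace (r t) with (((2 * a / t + 2) * f t + (- (2 * a / t + 2) * f t + r t))) by ring.
      exact H.
    - intros t Ht. specialize (Hr t Ht). pose proof (Rpower_pos t (2 * a)). pose proof (exp_pos (2 * t)).
      pose proof (Rmult_lt_0_compat _ _ H H1). nra.
    - intros t Ht Ht1. apply Rabs_Rpower_mul_le; lra.
    - apply continuous_Rmult; [apply continuous_exp_mul|assumption].
    - rewrite H0. ring. }
  pose proof (Rpower_pos x (2 * a)). pose proof (exp_pos (2 * x)).
  apply Rmult_le_reg_l with (Rpower x (2 * a) * exp (2 * x)); [now apply Rmult_lt_0_compat|]. lra.
Qed.

Lemma continuous_turan_geo (a x : R) : 0 <= a -> continuous (turan_geo a) x.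
Proof.
  intros Ha. unfold turan_geo.
  assert (Hg := continuous_kummer_g a x Ha). assert (Hh := continuous_kummer_h a x Ha).
  apply continuous_Rminus.
  - apply continuous_Rmult; [apply continuous_const|].
    apply continuous_Rminus; now apply continuous_Rmult.
  - repeat (apply continuous_Rmult; [|assumption]).
    apply continuous_Rmult; [apply continuous_const|apply continuous_id].
Qed.

Lemma turan_geo_nonpos (a x : R) : 0 <= a -> 0 < x -> turan_geo a x <= 0.
Proof.
  intros Ha. revert x. apply nonpos_of_integrating_factor with (a := a)
    (r := fun x => - 2 * kummer_g a x * kummer_h a x); auto.
  - intros x Hx. evar_last; [now apply is_derive_turan_geo|simpl; ring].
  - intros x Hx. pose proof (kummer_g_pos a x Ha ltac:(lra)). pose proof (kummer_h_pos a x Ha ltac:(lra)).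
    nra.
  - now apply continuous_turan_geo.
  - unfold turan_geo. rewrite kummer_g_0, kummer_h_0. ring.
Qed.

(** D <= 0 reads a (g - h) (g + h) <= 2 x g h; division by g + h gives the claim, strictly because g
    < g + h. *)
Lemma kummer_gap (a x : R) : 0 <= a -> 0 < x ->
  a * (kummer_g a x - kummer_h a x) < 2 * x * kummer_h a x.
Proof.
  intros Ha Hx. pose proof (turan_geo_nonpos a x Ha Hx) as H. unfold turan_geo in H.
  pose proof (kummer_g_pos a x Ha ltac:(lra)). pose proof (kummer_h_pos a x Ha ltac:(lra)).
  apply Rmult_lt_reg_r with (kummer_g a x + kummer_h a x); [lra|].
  assert (0 < x * (kummer_h a x * kummer_h a x)) by (apply Rmult_lt_0_compat; [lra|nra]).
  lra.
Qed.

(** Log-convexity rests on geometric concavity: the forcing term (g - h) (a (g - h)/x - 2 g) is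
    nonpositive by [kummer_gap] and h <= g. *)
Lemma turan_log_nonpos (a x : R) : 0 <= a -> 0 < x -> turan_log a x <= 0.
Proof.
  intros Ha. revert x. apply nonpos_of_integrating_factor with (a := a)
    (r := fun x => (kummer_g a x - kummer_h a x) *
       (a * (kummer_g a x - kummer_h a x) / x - 2 * kummer_g a x)); auto.
  - intros x Hx. now apply is_derive_turan_log.
  - intros x Hx. pose proof (kummer_h_le_g a x Ha ltac:(lra)) as H1.
    pose proof (kummer_gap a x Ha Hx) as H2.
    assert (a * (kummer_g a x - kummer_h a x) / x <= 2 * kummer_g a x).
    { apply Rle_div_l; [lra|]. nra. }
    nra.
  - unfold turan_log.
    assert (Hg := continuous_kummer_g a 0 Ha). assert (Hh := continuous_kummer_h a 0 Ha).
    apply continuous_Rminus.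
    + apply (continuous_opp (V := R_NormedModule)). now apply continuous_turan_geo.
    + apply continuous_Rmult; [assumption|]. now apply continuous_Rminus.
  - unfold turan_log, turan_geo. rewrite kummer_g_0, kummer_h_0. ring.
Qed.

(** The predicate m is an interval: (0, oo) for log-convexity, the whole line for the variable ln x.
    The intermediate point divides [x, y] in the ratio 1 - l to l, and the mean slopes on its two
    sides are ordered. *)
Lemma convex_of_derive_mono (F F' : R -> R) (m : R -> Prop) :
  (forall s t u, m s -> m u -> s <= t <= u -> m t) ->
  (forall t, m t -> is_derive F t (F' t)) ->
  (forall s t, m s -> m t -> s <= t -> F' s <= F' t) ->
  forall x y l, m x -> m y -> 0 <= l <= 1 ->
    F (l * x + (1 - l) * y) <= l * F x + (1 - l) * F y.
Proof.
  intros Hm Hd Hmono.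
  assert (H : forall x y l, m x -> m y -> x <= y -> 0 <= l <= 1 ->
    F (l * x + (1 - l) * y) <= l * F x + (1 - l) * F y).
  { intros x y l Hx Hy Hxy Hl. set (z := l * x + (1 - l) * y).
    assert (Hz : x <= z <= y) by (unfold z; split; nra).
    destruct (MVT_is_derive F F' x z) as (c1 & Hc1 & E1); [lra|intros; apply Hd, (Hm x _ y); auto; lra|].
    destruct (MVT_is_derive F F' z y) as (c2 & Hc2 & E2); [lra|intros; apply Hd, (Hm x _ y); auto; lra|].
    assert (Hc : F' c1 <= F' c2).
    { apply Hmono; [apply (Hm x _ y)|apply (Hm x _ y)|]; auto; lra. }
    replace (z - x) with ((1 - l) * (y - x)) in E1 by (unfold z; ring).
    replace (y - z) with (l * (y - x)) in E2 by (unfold z; ring).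
    assert (Hp : 0 <= l * (1 - l) * (y - x)) by (apply Rmult_le_pos; [apply Rmult_le_pos|]; lra).
    replace (F z) with (l * F z + (1 - l) * F z) by ring.
    assert (l * (F z - F x) <= (1 - l) * (F y - F z)); [|lra].
    rewrite E1, E2.
    replace (l * (F' c1 * ((1 - l) * (y - x)))) with (l * (1 - l) * (y - x) * F' c1) by ring.
    replace ((1 - l) * (F' c2 * (l * (y - x)))) with (l * (1 - l) * (y - x) * F' c2) by ring.
    now apply Rmult_le_compat_l. }
  intros x y l Hx Hy Hl. destruct (Rle_dec x y) as [Hxy|Hxy]; [now apply H|].
  replace (l * x + (1 - l) * y) with ((1 - l) * y + (1 - (1 - l)) * x) by ring.
  replace (l * F x + (1 - l) * F y) with ((1 - l) * F y + (1 - (1 - l)) * F x) by ring.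
  apply H; auto; lra.
Qed.

(** * Log-convexity and geometric concavity *)

Lemma Phi_pos (nu x : R) : -1/2 <= nu -> 0 < x -> 0 < Phi nu x.
Proof.
  intros Hnu Hx. rewrite Phi_eq_kummer by assumption.
  apply Rmult_lt_0_compat; [apply Phi0_pos|apply kummer_g_pos]; lra.
Qed.

Lemma ln_Phi (nu x : R) : -1/2 <= nu -> 0 < x ->
  ln (Phi nu x) = ln (Phi0 nu) + ln (kummer_g (nu + 1/2) x).
Proof.
  intros Hnu Hx. rewrite Phi_eq_kummer by assumption.
  apply ln_mult; [apply Phi0_pos|apply kummer_g_pos]; lra.
Qed.

Lemma Phi_log_convex (nu : R) : -1/2 <= nu -> log_convex_pos (Phi nu).
Proof.
  intros Hnu. split; [intros; now apply Phi_pos|].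
  intros x y l Hx Hy Hl.
  assert (Hz : 0 < l * x + (1 - l) * y).
  { destruct (Req_dec l 0) as [->|]; [lra|].
    apply Rplus_lt_le_0_compat; [apply Rmult_lt_0_compat|apply Rmult_le_pos]; lra. }
  rewrite !ln_Phi by assumption. set (a := nu + 1/2). assert (Ha : 0 <= a) by (unfold a; lra).
  enough (ln (kummer_g a (l * x + (1 - l) * y)) <= l * ln (kummer_g a x) + (1 - l) * ln (kummer_g a y))
    by lra.
  apply (convex_of_derive_mono (fun x => ln (kummer_g a x))
    (fun x => a * (kummer_h a x - kummer_g a x) / (x * kummer_g a x)) (fun x => 0 < x)); auto.
  - intros; lra.
  - intros t Ht. pose proof (is_derive_kummer_g a t Ha Ht) as H1.
    pose proof (kummer_g_pos a t Ha ltac:(lra)).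
    auto_derive; [split; [eexists; eassumption|tauto]|].
    eta_Derive. rewrite (is_derive_unique _ _ _ H1). field. lra.
  - intros s t Hs Ht Hst. apply Ropp_le_cancel.
    apply (nonincreasing_of_derive (fun x => - (a * (kummer_h a x - kummer_g a x) / (x * kummer_g a x)))
      (fun x => a * turan_log a x / (x * x * (kummer_g a x * kummer_g a x)))); [assumption| |].
    + intros r [Hr _]. assert (Hr0 : 0 < r) by lra.
      pose proof (is_derive_kummer_g a r Ha Hr0) as H1. pose proof (is_derive_kummer_h a r Ha Hr0) as H2.
      pose proof (kummer_g_pos a r Ha ltac:(lra)).
      auto_derive.
      { repeat split; try (eexists; eassumption). apply Rgt_not_eq, Rmult_lt_0_compat; lra. }
      eta_Derive. rewrite (is_derive_unique _ _ _ H1), (is_derive_unique _ _ _ H2).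
      unfold turan_log, turan_geo. field. lra.
    + intros r [Hr _]. pose proof (turan_log_nonpos a r Ha ltac:(lra)) as H1.
      pose proof (kummer_g_pos a r Ha ltac:(lra)) as H2.
      apply Ropp_le_cancel. rewrite Ropp_0. unfold Rdiv. rewrite Ropp_mult_distr_l.
      apply Rdiv_le_0_compat; [nra|]. apply Rmult_lt_0_compat; nra.
Qed.

Lemma Phi_geom_concave (nu : R) : -1/2 <= nu -> geom_concave_pos (Phi nu).
Proof.
  intros Hnu. split; [intros; now apply Phi_pos|].
  intros x y l Hx Hy Hl.
  assert (E : Rpower x l * Rpower y (1 - l) = exp (l * ln x + (1 - l) * ln y)).
  { unfold Rpower. now rewrite exp_plus. }
  assert (E' : Rpower (Phi nu x) l * Rpower (Phi nu y) (1 - l) =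
    exp (l * ln (Phi nu x) + (1 - l) * ln (Phi nu y))).
  { unfold Rpower. now rewrite exp_plus. }
  rewrite E, E'. rewrite <- (exp_ln (Phi nu (exp _))) by (apply Phi_pos; [assumption|apply exp_pos]).
  apply exp_le. rewrite !ln_Phi by (try assumption; apply exp_pos).
  set (a := nu + 1/2). assert (Ha : 0 <= a) by (unfold a; lra).
  (* In the variable t = ln x the claim is convexity of -ln g(e^t), whose derivative is -x g'/g = a
     (g - h)/g at x = e^t. *)
  enough (- ln (kummer_g a (exp (l * ln x + (1 - l) * ln y))) <=
    l * - ln (kummer_g a (exp (ln x))) + (1 - l) * - ln (kummer_g a (exp (ln y)))) as H.
  { rewrite !exp_ln in H by assumption. lra. }
  apply (convex_of_derive_mono (fun t => - ln (kummer_g a (exp t)))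
    (fun t => a * (kummer_g a (exp t) - kummer_h a (exp t)) / kummer_g a (exp t)) (fun _ => True)); auto.
  - intros t _. pose proof (is_derive_kummer_g a (exp t) Ha (exp_pos t)) as H1.
    pose proof (exp_pos t). pose proof (kummer_g_pos a (exp t) Ha ltac:(lra)).
    auto_derive; [split; [eexists; eassumption|tauto]|].
    eta_Derive. rewrite (is_derive_unique _ _ _ H1). field. lra.
  - intros s t _ _ Hst. apply Ropp_le_cancel.
    apply (nonincreasing_of_derive (fun x => - (a * (kummer_g a x - kummer_h a x) / kummer_g a x))
      (fun x => a * turan_geo a x / (x * (kummer_g a x * kummer_g a x)))); [now apply exp_le| |].
    + intros r [Hr _]. assert (Hr0 : 0 < r) by (pose proof (exp_pos s); lra).
      pose proof (is_derive_kummer_g a r Ha Hr0) as H1. pose proof (is_derive_kummer_h a r Ha Hr0) as H2.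
      pose proof (kummer_g_pos a r Ha ltac:(lra)).
      auto_derive.
      { repeat split; try (eexists; eassumption). lra. }
      eta_Derive. rewrite (is_derive_unique _ _ _ H1), (is_derive_unique _ _ _ H2).
      unfold turan_geo. field. lra.
    + intros r [Hr _]. assert (Hr0 : 0 < r) by (pose proof (exp_pos s); lra).
      pose proof (turan_geo_nonpos a r Ha Hr0) as H1.
      pose proof (kummer_g_pos a r Ha ltac:(lra)) as H2.
      apply Ropp_le_cancel. rewrite Ropp_0. unfold Rdiv. rewrite Ropp_mult_distr_l.
      apply Rdiv_le_0_compat; [nra|]. apply Rmult_lt_0_compat; nra.
Qed.

(** * Power weights with a shifted base *)

(** The numerator is x h - s (g - h), so s = a/2 is the largest shift that [kummer_gap] affords. The
    shifts 0, nu/2 and nu/2 + 1/4 of (d), (e) and (f) all respect it; in (e) the shift may be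
    negative. *)
Lemma shifted_slope_pos (a s x : R) : 0 <= a -> s <= a / 2 -> 0 < x -> 0 < x + s ->
  0 < kummer_g a x / (x + s) + (kummer_h a x - kummer_g a x) / x.
Proof.
  intros Ha Hs Hx Hxs. pose proof (kummer_gap a x Ha Hx) as H.
  pose proof (kummer_h_le_g a x Ha ltac:(lra)).
  replace (kummer_g a x / (x + s) + (kummer_h a x - kummer_g a x) / x)
    with ((x * kummer_h a x - s * (kummer_g a x - kummer_h a x)) / ((x + s) * x)) by (field; lra).
  apply Rdiv_lt_0_compat; [nra|now apply Rmult_lt_0_compat].
Qed.

Lemma is_derive_shifted (a s x : R) : 0 <= a -> 0 < x -> 0 < x + s ->
  is_derive (fun x => Rpower (x + s) a * kummer_g a x) x
    (Rpower (x + s) a * a * (kummer_g a x / (x + s) + (kummer_h a x - kummer_g a x) / x)).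
Proof.
  intros Ha Hx Hxs. pose proof (is_derive_kummer_g a x Ha Hx) as H1.
  unfold Rpower. auto_derive; [repeat split; [assumption|eexists; eassumption]|].
  eta_Derive. rewrite (is_derive_unique _ _ _ H1). field. lra.
Qed.

Lemma shifted_kummer_nondecreasing (a s x y : R) : 0 <= a -> s <= a / 2 -> 0 < x -> 0 < x + s -> x <= y ->
  Rpower (x + s) a * kummer_g a x <= Rpower (y + s) a * kummer_g a y.
Proof.
  intros Ha Hs Hx Hxs Hxy. 
  destruct (MVT_is_derive _ _ x y Hxy (fun t Ht => is_derive_shifted a s t Ha
    ltac:(destruct Ht; lra) ltac:(destruct Ht; lra))) as (c & Hc & E).
  pose proof (shifted_slope_pos a s c Ha Hs ltac:(lra) ltac:(lra)).
  pose proof (Rpower_pos (c + s) a).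
  match type of E with _ = ?r * _ => assert (0 <= r) end.
  { apply Rmult_le_pos; [apply Rmult_le_pos|]; lra. }
  nra.
Qed.

(** The derivative carries a factor a, hence a > 0 here. This version makes the inequalities of (g)
    strict. *)
Lemma shifted_kummer_increasing (a s x y : R) : 0 < a -> s <= a / 2 -> 0 < x -> 0 < x + s -> x < y ->
  Rpower (x + s) a * kummer_g a x < Rpower (y + s) a * kummer_g a y.
Proof.
  intros Ha Hs Hx Hxs Hxy.
  destruct (MVT_is_derive _ _ x y ltac:(lra) (fun t Ht => is_derive_shifted a s t ltac:(lra)
    ltac:(destruct Ht; lra) ltac:(destruct Ht; lra))) as (c & Hc & E).
  pose proof (shifted_slope_pos a s c ltac:(lra) Hs ltac:(lra) ltac:(lra)).
  pose proof (Rpower_pos (c + s) a).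
  match type of E with _ = ?r * _ => assert (0 < r) end.
  { repeat apply Rmult_lt_0_compat; lra. }
  nra.
Qed.

Lemma shifted_Phi_nondecreasing (nu s x y : R) : -1/2 <= nu -> s <= nu / 2 + 1/4 ->
  0 < x -> 0 < x + s -> x <= y ->
  Rpower (x + s) (nu + 1/2) * Phi nu x <= Rpower (y + s) (nu + 1/2) * Phi nu y.
Proof.
  intros Hnu Hs Hx Hxs Hxy. rewrite !Phi_eq_kummer by lra.
  pose proof (shifted_kummer_nondecreasing (nu + 1/2) s x y ltac:(lra) ltac:(lra) Hx Hxs Hxy).
  pose proof (Phi0_pos nu ltac:(lra)). nra.
Qed.

(** * Derivatives of all orders *)

Lemma kummer_g_derive_n (a : R) (m : nat) : 0 <= a ->
  exists C, 0 <= C /\ forall x, is_derive_n (kummer_g a) m x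
    ((-1) ^ m * C * (exp (- (2 * x)) * kummer (a + 1) (2 * a + 1 + INR m) (2 * x))).
Proof.
  intros Ha. induction m as [|m (C & HC & IH)].
  - exists 1. split; [lra|]. intros x. simpl. unfold kummer_g. rewrite Rplus_0_r. ring.
  - pose proof (pos_INR m). set (b := 2 * a + 1 + INR m) in *.
    (* Here b - c = (2a + 1 + m) - (a + 1) = a + m, and the 2 is the inner derivative of 2x. The
       constant may vanish, as it does at the first step when a = 0. *)
    exists (2 * C * ((a + INR m) / b)). split.
    { apply Rmult_le_pos; [lra|]. apply Rdiv_le_0_compat; unfold b; lra. }
    intros x. simpl. apply is_derive_ext with
      (fun x => (-1) ^ m * C * (exp (- (2 * x)) * kummer (a + 1) b (2 * x))).
    { intros t. symmetry. apply is_derive_n_unique, IH. }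
    evar_last.
    + apply is_derive_scal, is_derive_exp_kummer; unfold b; lra.
    + rewrite dkummer_minus by (unfold b; lra).
      change (match m with O => 1 | S _ => INR m + 1 end) with (INR (S m)). rewrite S_INR.
      replace (2 * a + 1 + (INR m + 1)) with (b + 1) by (unfold b; ring).
      replace (b - (a + 1)) with (a + INR m) by (unfold b; ring).
      simpl. ring.
Qed.

Lemma Phi_completely_monotonic (nu : R) : -1/2 <= nu -> completely_monotonic (Phi nu).
Proof.
  intros Hnu m x Hx.
  destruct (kummer_g_derive_n (nu + 1/2) m ltac:(lra)) as (C & HC & H).
  specialize (H x). apply (is_derive_n_scal_l _ _ (Phi0 nu)) in H.
  set (l := Phi0 nu * _) in H.
  assert (HP : is_derive_n (Phi nu) m x l).
  { apply (is_derive_n_ext_loc (fun t => Phi0 nu * kummer_g (nu + 1/2) t)); [|exact H].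
    exists (mkposreal x Hx). intros t Ht. apply Rabs_def2 in Ht.
    unfold minus, plus, opp in Ht; simpl in Ht. symmetry. apply Phi_eq_kummer; lra. }
  split.
  - destruct m as [|m]; [exact I|]. exists l. exact HP.
  - rewrite (is_derive_n_unique _ _ _ _ HP). unfold l.
    assert (Hs : (-1) ^ m * (-1) ^ m = 1).
    { rewrite <- Rpow_mult_distr. replace (-1 * -1) with 1 by ring. apply pow1. }
    match goal with |- 0 <= _ * (_ * (_ * C * ?E)) =>
      replace ((-1) ^ m * (Phi0 nu * ((-1) ^ m * C * E)))
        with (((-1) ^ m * (-1) ^ m) * (Phi0 nu * (C * E))) by ring; assert (0 < E) end.
    { pose proof (pos_INR m). apply Rmult_lt_0_compat; [apply exp_pos|apply kummer_pos; lra]. }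
    rewrite Hs, Rmult_1_l. pose proof (Phi0_pos nu ltac:(lra)).
    apply Rmult_le_pos; [lra|]. apply Rmult_le_pos; lra.
Qed.

(** * Monotonicity in the order, and bounds *)

Lemma scaled_bessel_term_antitone (x nu1 nu2 d : R) (k : nat) :
  0 < x -> 0 <= nu1 -> nu1 <= nu2 -> 0 <= d ->
  Rpower x (- nu2) * bessel_term (nu2 + d) x k <= Rpower x (- nu1) * bessel_term (nu1 + d) x k.
Proof.
  intros Hx H1 H12 Hd.
  (* The offset d is 0 for I_nu and 1 for I_(nu+1). Cancelling x^nu against (x/2)^nu leaves nu only
     in the product 2^nu Gamma(k + d + 1 + nu), whose Gamma argument is at least 1. *)
  assert (E : forall nu, 0 <= nu -> Rpower x (- nu) * bessel_term (nu + d) x k =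
    Rpower (x / 2) (2 * INR k + d) / INR (Factorial.fact k) *
      / (Rpower 2 nu * Gamma (INR k + d + 1 + nu))).
  { intros nu Hnu. unfold bessel_term.
    replace (2 * INR k + (nu + d)) with (nu + (2 * INR k + d)) by ring.
    replace (INR k + (nu + d) + 1) with (INR k + d + 1 + nu) by ring.
    rewrite (Rpower_plus nu), (Rpower_Rdiv x 2 nu), Rpower_Ropp by lra.
    pose proof (pos_INR k). pose proof (Gamma_pos (INR k + d + 1 + nu) ltac:(lra)).
    pose proof (Rpower_pos 2 nu). pose proof (Rpower_pos x nu). pose proof (INR_fact_lt_0 k).
    field. lra. }
  rewrite !E by lra. pose proof (pos_INR k). pose proof (INR_fact_lt_0 k).
  apply Rmult_le_compat_l.
  - left. apply Rdiv_lt_0_compat; [apply Rpower_pos|assumption].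
  - pose proof (Gamma_pos (INR k + d + 1 + nu1) ltac:(lra)). pose proof (Rpower_pos 2 nu1).
    apply Rinv_le_contravar; [now apply Rmult_lt_0_compat|].
    pose proof (Rpower_2_Gamma_mono (INR k + d + 1 + nu1) (nu2 - nu1) ltac:(lra) ltac:(lra)) as HG.
    replace (INR k + d + 1 + nu1 + (nu2 - nu1)) with (INR k + d + 1 + nu2) in HG by ring.
    replace nu2 with (nu1 + (nu2 - nu1)) at 1 by ring. rewrite Rpower_plus, Rmult_assoc.
    apply Rmult_le_compat_l; lra.
Qed.

Lemma bessel_term_pos (nu x : R) (k : nat) : -1 < nu -> 0 < x -> 0 < bessel_term nu x k.
Proof.
  intros Hnu Hx. pose proof (pos_INR k).
  apply Rdiv_lt_0_compat; [apply Rpower_pos|].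
  apply Rmult_lt_0_compat; [apply INR_fact_lt_0|apply Gamma_pos; lra].
Qed.

Lemma scaled_BesselI_antitone (x nu1 nu2 d : R) :
  0 < x -> 0 <= nu1 -> nu1 <= nu2 -> 0 <= d ->
  Rpower x (- nu2) * BesselI (nu2 + d) x <= Rpower x (- nu1) * BesselI (nu1 + d) x.
Proof.
  intros Hx H1 H12 Hd. unfold BesselI. rewrite <- !Series_scal_l. apply Series_le.
  - intros k. split; [|now apply scaled_bessel_term_antitone].
    left. apply Rmult_lt_0_compat; [apply Rpower_pos|apply bessel_term_pos; lra].
  - apply (ex_series_scal (V := R_NormedModule)). apply ex_series_bessel_term; lra.
Qed.

Lemma Phi_antitone (x nu1 nu2 : R) : 0 < x -> 0 <= nu1 -> nu1 <= nu2 -> Phi nu2 x <= Phi nu1 x.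
Proof.
  intros Hx H1 H12. unfold Phi. rewrite !Rmult_assoc.
  apply Rmult_le_compat_l; [left; apply exp_pos|].
  pose proof (scaled_BesselI_antitone x nu1 nu2 0 Hx H1 H12 ltac:(lra)) as E0.
  pose proof (scaled_BesselI_antitone x nu1 nu2 1 Hx H1 H12 ltac:(lra)) as E1.
  rewrite !Rplus_0_r in E0. lra.
Qed.

(* By Gamma_Wendel and weighted AM-GM,
   y^p / Gamma (s + p) <= y^p (s + p)^(1-p) / (s Gamma s) <= (p y + (1-p) (s+p)) / (s Gamma s). *)
Lemma bessel_term_interpolation (nu p x : R) (k : nat) : -1 < nu -> 0 <= p <= 1 -> 0 < x ->
  bessel_term (nu + p) x k <=
  (1 - p) * bessel_term nu x k + p * (1 + 2 * (1 - p) / x) * bessel_term (nu + 1) x k.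
Proof.
  intros Hnu Hp Hx. unfold bessel_term. pose proof (pos_INR k). set (y := x / 2).
  assert (Hy : 0 < y) by (unfold y; lra).
  set (s := INR k + nu + 1). assert (Hs : 0 < s) by (unfold s; lra).
  replace (INR k + (nu + p) + 1) with (s + p) by (unfold s; ring).
  replace (INR k + (nu + 1) + 1) with (s + 1) by (unfold s; ring).
  rewrite <- !Rplus_assoc, !(Rpower_plus (2 * INR k + nu)), Rpower_1, Gamma_succ by assumption.
  pose proof (INR_fact_lt_0 k) as Hf. pose proof (Rpower_pos y (2 * INR k + nu)) as HR.
  pose proof (Gamma_pos s Hs) as HG. pose proof (Gamma_pos (s + p) ltac:(lra)) as HGp.
  set (r := Rpower y (2 * INR k + nu)) in *.
  pose proof (Gamma_Wendel s p Hs Hp) as HW.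
  pose proof (Rpower_weighted_amgm y (s + p) p Hy ltac:(lra) Hp) as HA.
  assert (HK : Rpower y p / Gamma (s + p) <= (p * y + (1 - p) * (s + p)) / (s * Gamma s)).
  { apply Rle_trans with (Rpower y p * Rpower (s + p) (1 - p) / (s * Gamma s)).
    - unfold Rdiv. rewrite Rmult_assoc. apply Rmult_le_compat_l; [left; apply Rpower_pos|].
      apply Rmult_le_reg_l with (s * Gamma s * Gamma (s + p)); [repeat apply Rmult_lt_0_compat; lra|].
      replace (s * Gamma s * Gamma (s + p) * / Gamma (s + p)) with (s * Gamma s) by (field; lra).
      replace (s * Gamma s * Gamma (s + p) * (Rpower (s + p) (1 - p) * / (s * Gamma s)))
        with (Gamma (s + p) * Rpower (s + p) (1 - p)) by (field; lra). exact HW.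
    - apply Rmult_le_compat_r; [|exact HA]. left. apply Rinv_0_lt_compat, Rmult_lt_0_compat; lra. }
  replace (r * Rpower y p / (INR (Factorial.fact k) * Gamma (s + p)))
    with (r / INR (Factorial.fact k) * (Rpower y p / Gamma (s + p))) by (field; lra).
  apply Rle_trans with (r / INR (Factorial.fact k) * ((p * y + (1 - p) * (s + p)) / (s * Gamma s))).
  - apply Rmult_le_compat_l; [left; now apply Rdiv_lt_0_compat|exact HK].
  - right. replace (2 * (1 - p) / x) with ((1 - p) / y) by (unfold y; field; lra). field. lra.
Qed.

(** The correction 2 (1-p)/x comes from (1-p)(s+p) = (1-p) s + p (1-p) in the termwise bound: the
    part with s yields the term of I_nu, and p (1-p) joins p y, with y = x/2, in that of
    I_(nu+1). *)
Lemma BesselI_interpolation (nu p x : R) : -1 < nu -> 0 <= p <= 1 -> 0 < x ->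
  BesselI (nu + p) x <=
  (1 - p) * BesselI nu x + p * (1 + 2 * (1 - p) / x) * BesselI (nu + 1) x.
Proof.
  intros Hnu Hp Hx. unfold BesselI at 2 3. rewrite <- !Series_scal_l, <- Series_plus.
  - apply Series_le.
    + intros k. split; [|now apply bessel_term_interpolation]. left. apply bessel_term_pos; lra.
    + apply (ex_series_plus (V := R_NormedModule));
        apply (ex_series_scal (V := R_NormedModule)); apply ex_series_bessel_term; lra.
  - apply (ex_series_scal (V := R_NormedModule)); apply ex_series_bessel_term; lra.
  - apply (ex_series_scal (V := R_NormedModule)); apply ex_series_bessel_term; lra.
Qed.

Lemma BesselI_pos (nu x : R) : -1 < nu -> 0 < x -> 0 < BesselI nu x.
Proof.
  intros Hnu Hx. rewrite BesselI_eq by assumption. apply Rmult_lt_0_compat.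
  - apply Rdiv_lt_0_compat; [apply Rpower_pos|apply Gamma_pos; lra].
  - apply PSeries_pos; [apply CV_radius_bessel_coeff; lra| | |apply pow2_ge_0].
    + intros n. left. apply Rinv_0_lt_compat, Rmult_lt_0_compat; [apply INR_fact_lt_0|apply poch_pos; lra].
    + unfold bessel_coeff; simpl. lra.
Qed.

(** * Comparison with order -1/2 *)

(** The difference is a positive multiple of [kummer_h]. *)
Lemma BesselI_succ_le (nu x : R) : -1/2 <= nu -> 0 < x -> BesselI (nu + 1) x <= BesselI nu x.
Proof.
  intros Hnu Hx. pose proof (BesselI_sub_eq nu x Hnu Hx) as H.
  pose proof (kummer_h_pos (nu + 1/2) x ltac:(lra) ltac:(lra)). pose proof (Phi0_pos nu ltac:(lra)).
  pose proof (exp_pos (- x)). pose proof (Rpower_pos x (- nu)).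
  assert (0 < exp (- x) * Rpower x (- nu)) by now apply Rmult_lt_0_compat.
  assert (0 < Phi0 nu * kummer_h (nu + 1/2) x) by now apply Rmult_lt_0_compat.
  nra.
Qed.

Lemma BesselI_add_INR_le (nu x : R) (n : nat) : -1/2 <= nu -> 0 < x ->
  BesselI (nu + INR n) x <= BesselI nu x.
Proof.
  intros Hnu Hx. induction n as [|n IH]; [simpl; rewrite Rplus_0_r; lra|].
  rewrite S_INR, <- Rplus_assoc. eapply Rle_trans; [|exact IH].
  pose proof (pos_INR n). apply BesselI_succ_le; lra.
Qed.

(** Write nu = -1/2 + n + p and interpolate between the orders -1/2 + n and -1/2 + n + 1. Integer
    steps only decrease I, and the excess 2 p (1-p)/x is at most 2/x. *)
Lemma BesselI_le_half (nu x : R) : -1/2 <= nu -> 0 < x ->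
  BesselI nu x <= (1 + 2 / x) * BesselI (-1/2) x.
Proof.
  intros Hnu Hx. destruct (nfloor_ex (nu + 1/2) ltac:(lra)) as [n Hn].
  set (p := nu + 1/2 - INR n). assert (Hp : 0 <= p <= 1) by (unfold p; lra).
  pose proof (pos_INR n).
  pose proof (BesselI_interpolation (-1/2 + INR n) p x ltac:(lra) Hp Hx) as H1.
  replace (-1/2 + INR n + p) with nu in H1 by (unfold p; field).
  pose proof (BesselI_add_INR_le (-1/2) x n ltac:(lra) Hx) as H2.
  pose proof (BesselI_add_INR_le (-1/2) x (S n) ltac:(lra) Hx) as H3.
  rewrite S_INR, <- Rplus_assoc in H3.
  pose proof (BesselI_pos (-1/2) x ltac:(lra) Hx) as H4.
  set (I := BesselI (-1/2) x) in *.
  assert (Hx2 : 0 < 2 / x) by (apply Rdiv_lt_0_compat; lra).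
  replace (2 * (1 - p) / x) with (2 / x * (1 - p)) in H1 by (field; lra).
  assert (Hq : 0 <= p * (1 + 2 / x * (1 - p))) by (apply Rmult_le_pos; nra).
  assert (H5 : p * (1 + 2 / x * (1 - p)) * BesselI (-1/2 + INR n + 1) x <= p * (1 + 2 / x * (1 - p)) * I)
    by (now apply Rmult_le_compat_l).
  assert (H6 : (1 - p) * BesselI (-1/2 + INR n) x <= (1 - p) * I) by (apply Rmult_le_compat_l; lra).
  assert (H7 : p * (1 - p) <= 1) by nra.
  assert (H8 : 2 / x * (p * (1 - p)) * I <= 2 / x * 1 * I).
  { apply Rmult_le_compat_r; [lra|]. apply Rmult_le_compat_l; lra. }
  lra.
Qed.

(** For a = 0 the system decouples into g' = 0 and h' = -2 h, so g = 1 and h = e^(-2x), the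
    elementary form of I_(-1/2) and I_(1/2). Only upper bounds are required. *)
Lemma kummer_g_0_le (x : R) : 0 < x -> kummer_g 0 x <= 1.
Proof.
  intros Hx. apply Rminus_le. revert x Hx.
  apply (nonpos_of_derive_nonpos _ (fun _ => 0) (fun x => kummer_g 0 x - 1)).
  - intros x Hx. pose proof (is_derive_kummer_g 0 x ltac:(lra) Hx) as H.
    auto_derive; [eexists; eassumption|]. eta_Derive. rewrite (is_derive_unique _ _ _ H). field. lra.
  - intros; lra.
  - intros; lra.
  - apply continuous_Rminus; [apply continuous_kummer_g; lra|apply continuous_const].
  - rewrite kummer_g_0. ring.
Qed.

Lemma kummer_h_0_le (x : R) : 0 < x -> exp (2 * x) * kummer_h 0 x <= 1.
Proof.
  intros Hx. apply Rminus_le. revert x Hx.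
  apply (nonpos_of_derive_nonpos _ (fun _ => 0) (fun x => exp (2 * x) * kummer_h 0 x - 1)).
  - intros x Hx. pose proof (is_derive_kummer_h 0 x ltac:(lra) Hx) as H.
    auto_derive; [eexists; eassumption|]. eta_Derive. rewrite (is_derive_unique _ _ _ H). field. lra.
  - intros; lra.
  - intros; lra.
  - apply continuous_Rminus; [|apply continuous_const].
    apply continuous_Rmult; [apply continuous_exp_mul|apply continuous_kummer_h; lra].
  - rewrite kummer_h_0, Rmult_0_r, exp_0. ring.
Qed.

Lemma BesselI_half_le (x : R) : 0 < x ->
  Rpower x (1/2) * exp (- x) * BesselI (-1/2) x <= Phi0 (-1/2) * (1 + / (2 * x)) / 2.
Proof.
  intros Hx.
  pose proof (Phi_eq_kummer (-1/2) x ltac:(lra) Hx) as H1. unfold Phi in H1.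
  pose proof (BesselI_sub_eq (-1/2) x ltac:(lra) Hx) as H2.
  replace (- (-1/2)) with (1/2) in * by field. replace (-1/2 + 1/2) with 0 in * by field.
  pose proof (kummer_g_0_le x Hx) as Hg. pose proof (kummer_h_0_le x Hx) as Hh.
  pose proof (Phi0_pos (-1/2) ltac:(lra)) as HP. pose proof (exp_ineq1_le (2 * x)) as He.
  pose proof (kummer_h_pos 0 x ltac:(lra) ltac:(lra)).
  (* Weakening e^(-2x) to 1/(2x) keeps the final bound polynomial in 1/x, so that its limit at
     infinity is a value at 1/x = 0. *)
  assert (Hh' : kummer_h 0 x <= / (2 * x)).
  { apply Rmult_le_reg_l with (2 * x); [lra|]. rewrite Rinv_r by lra. nra. }
  assert (Phi0 (-1/2) * (kummer_g 0 x + kummer_h 0 x) <= Phi0 (-1/2) * (1 + / (2 * x))).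
  { apply Rmult_le_compat_l; lra. }
  lra.
Qed.

(** I_nu + I_(nu+1) is replaced by 2 I_nu and then compared with I_(-1/2); the errors are factors
    tending to 1, so the limiting constant is that of order -1/2. *)
Lemma Phi_asymptotic_le (nu x : R) : -1/2 <= nu -> 0 < x ->
  Rpower x (nu + 1/2) * Phi nu x <= Phi0 (-1/2) * ((1 + 2 / x) * (1 + / (2 * x))).
Proof.
  intros Hnu Hx. unfold Phi.
  replace (Rpower x (nu + 1/2) * (exp (- x) * Rpower x (- nu) * (BesselI nu x + BesselI (nu + 1) x)))
    with (Rpower x (1/2) * exp (- x) * (BesselI nu x + BesselI (nu + 1) x)).
  2:{ rewrite Rpower_plus, Rpower_Ropp. pose proof (Rpower_pos x nu). field. lra. }
  pose proof (BesselI_succ_le nu x Hnu Hx). pose proof (BesselI_le_half nu x Hnu Hx).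
  pose proof (BesselI_half_le x Hx) as H1.
  assert (Hr : 0 < Rpower x (1/2) * exp (- x)) by (apply Rmult_lt_0_compat; apply exp_pos).
  set (r := Rpower x (1/2) * exp (- x)) in *.
  assert (Hx2 : 0 < 2 / x) by (apply Rdiv_lt_0_compat; lra).
  apply Rle_trans with (r * (2 * ((1 + 2 / x) * BesselI (-1/2) x))).
  - apply Rmult_le_compat_l; lra.
  - apply (Rmult_le_compat_l (2 * (1 + 2 / x))) in H1; [|lra]. lra.
Qed.

(** * The value of Gamma at 1/2 *)

Definition wallis (n : nat) : R := RInt (fun t => cos t ^ n) 0 (PI / 2).

Lemma ex_RInt_cos_pow (n : nat) (a b : R) : ex_RInt (fun t => cos t ^ n) a b.
Proof.
  apply (ex_RInt_continuous (V := R_CompleteNormedModule)). intros t _.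
  apply (ex_derive_continuous (V := R_NormedModule)). auto_derive. trivial.
Qed.

Lemma wallis_0 : wallis 0 = PI / 2.
Proof.
  unfold wallis. simpl. rewrite RInt_const. unfold scal; simpl. unfold mult; simpl. ring.
Qed.

Lemma wallis_1 : wallis 1 = 1.
Proof.
  apply is_RInt_unique. replace 1 with (minus (sin (PI / 2)) (sin 0)).
  2:{ rewrite sin_PI2, sin_0. unfold minus, plus, opp; simpl. ring. }
  apply (is_RInt_derive (V := R_CompleteNormedModule) sin).
  - intros t _. auto_derive; [trivial|simpl; ring].
  - intros t _. apply (ex_derive_continuous (V := R_NormedModule)). auto_derive. trivial.
Qed.

(** The derivative of sin t cos^(n+1) t is (n+2) cos^(n+2) t - (n+1) cos^n t, and the primitive
    vanishes at 0 and at PI/2. *)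
Lemma wallis_succ_succ (n : nat) : INR (S (S n)) * wallis (S (S n)) = INR (S n) * wallis n.
Proof.
  set (f := fun t => INR (S (S n)) * cos t ^ S (S n) - INR (S n) * cos t ^ n).
  assert (H1 : is_RInt f 0 (PI / 2) 0).
  { replace 0 with (minus (sin (PI / 2) * cos (PI / 2) ^ S n) (sin 0 * cos 0 ^ S n)) at 2.
    2:{ rewrite sin_PI2, cos_PI2, sin_0, cos_0. unfold minus, plus, opp; simpl. ring. }
    apply (is_RInt_derive (V := R_CompleteNormedModule) (fun t => sin t * cos t ^ S n)).
    - intros t _. auto_derive; [trivial|]. unfold f.
      change (match n with O => 1 | S _ => INR n + 1 end) with (INR (S n)).
      replace (pred (S n)) with n by reflexivity. rewrite (S_INR (S n)).
      pose proof (sin2_cos2 t) as Hsc. unfold Rsqr in Hsc. simpl pow.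
      replace (sin t * (1 * - sin t * (INR (S n) * cos t ^ n)))
        with (- INR (S n) * (sin t * sin t) * cos t ^ n) by ring.
      replace (sin t * sin t) with (1 - cos t * cos t) by lra. ring.
    - intros t _. unfold f. apply (ex_derive_continuous (V := R_NormedModule)). auto_derive. trivial. }
  assert (H2 : is_RInt f 0 (PI / 2) (INR (S (S n)) * wallis (S (S n)) - INR (S n) * wallis n)).
  { apply (is_RInt_minus (V := R_NormedModule)); apply (is_RInt_scal (V := R_NormedModule));
      apply (RInt_correct (V := R_CompleteNormedModule)), ex_RInt_cos_pow. }
  pose proof (is_RInt_unique _ _ _ _ H1) as E1. pose proof (is_RInt_unique _ _ _ _ H2) as E2.
  rewrite E1 in E2. lra.
Qed.

Lemma wallis_antitone (n : nat) : wallis (S n) <= wallis n.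
Proof.
  pose proof PI_RGT_0. apply RInt_le; [lra|apply ex_RInt_cos_pow|apply ex_RInt_cos_pow|].
  intros t Ht. pose proof (cos_ge_0 t ltac:(lra) ltac:(lra)). pose proof (COS_bound t).
  pose proof (pow_le (cos t) n ltac:(lra)). simpl. nra.
Qed.

Lemma wallis_even (n : nat) :
  wallis (2 * n) * INR (Factorial.fact n) = PI / 2 * poch (1/2) n.
Proof.
  induction n as [|n IH]; [simpl Nat.mul; rewrite wallis_0; simpl; ring|].
  replace (2 * S n)%nat with (S (S (2 * n))) by lia.
  pose proof (wallis_succ_succ (2 * n)) as H. rewrite !S_INR, mult_INR in H. replace (INR 2) with 2 in H by (simpl; ring).
  rewrite fact_simpl, mult_INR, S_INR. simpl poch.
  pose proof (pos_INR n). pose proof (INR_fact_lt_0 n).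
  replace (wallis (S (S (2 * n)))) with ((INR n + 1/2) / (INR n + 1) * wallis (2 * n)).
  2:{ apply Rmult_eq_reg_l with (2 * INR n + 1 + 1); [|lra]. rewrite H. field. lra. }
  replace ((INR n + 1 / 2) / (INR n + 1) * wallis (2 * n) * ((INR n + 1) * INR (Factorial.fact n)))
    with ((INR n + 1/2) * (wallis (2 * n) * INR (Factorial.fact n))) by (field; lra).
  rewrite IH. ring.
Qed.

Lemma wallis_odd (n : nat) :
  wallis (2 * n + 1) * (2 * INR n + 1) * poch (1/2) n = INR (Factorial.fact n).
Proof.
  induction n as [|n IH]; [simpl Nat.mul; simpl Nat.add; rewrite wallis_1; simpl; ring|].
  replace (2 * S n + 1)%nat with (S (S (2 * n + 1))) by lia.
  pose proof (wallis_succ_succ (2 * n + 1)) as H. rewrite !S_INR, plus_INR, mult_INR in H.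
  replace (INR 2) with 2 in H by (simpl; ring). simpl (INR 1) in H.
  rewrite fact_simpl, mult_INR, S_INR. simpl poch.
  pose proof (pos_INR n).
  replace (wallis (S (S (2 * n + 1))) * (2 * (INR n + 1) + 1)) with ((2 * INR n + 2) * wallis (2 * n + 1)).
  2:{ lra. }
  rewrite <- IH. field.
Qed.

(* Wallis' product, with the central Gamma quotient estimated by Gamma_Wendel. *)
Lemma Gamma_half_ge (n : nat) : PI * (INR n + 1/2) / (INR n + 1) <= Gamma (1/2) ^ 2.
Proof.
  pose proof (pos_INR n). pose proof (INR_fact_lt_0 n) as Hf.
  pose proof (poch_pos (1/2) n ltac:(lra)) as Hp. pose proof PI_RGT_0.
  pose proof (Gamma_pos (1/2) ltac:(lra)) as HG.
  (* The left-hand side is the next even integral, of order 2n + 2, by the recurrence. *)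
  assert (HW : (INR n + 1/2) / (INR n + 1) * wallis (2 * n) <= wallis (2 * n + 1)).
  { replace (2 * n + 1)%nat with (S (2 * n)) by lia.
    eapply Rle_trans; [|apply wallis_antitone].
    pose proof (wallis_succ_succ (2 * n)) as E. rewrite !S_INR, mult_INR in E. replace (INR 2) with 2 in E by (simpl; ring).
    right. apply Rmult_eq_reg_l with (2 * INR n + 1 + 1); [|lra]. rewrite E. field. lra. }
  assert (HGn : Gamma (INR n + 1) = INR (Factorial.fact n)).
  { rewrite Gamma_add_INR, Gamma_1 by lra. clear. rewrite Rmult_1_r. induction n as [|n IH]; [reflexivity|].
    simpl poch. rewrite IH, fact_simpl, mult_INR, S_INR. ring. }
  pose proof (Gamma_Wendel (INR n + 1) (1/2) ltac:(lra) ltac:(lra)) as H1.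
  rewrite HGn in H1.
  replace (INR n + 1 + 1/2) with (INR n + 1/2 + 1) in H1 by ring.
  rewrite Gamma_succ, Gamma_add_INR in H1 by lra.
  replace (1 - 1/2) with (/ 2) in H1 by field. rewrite Rpower_sqrt in H1 by lra.
  (* Square Wendel's inequality at s = n + 1, p = 1/2, and use (n + 1/2)(n + 3/2) <= (n + 1)^2. *)
  assert (H2 : INR (Factorial.fact n) ^ 2 <= (INR n + 1/2) * (poch (1/2) n * Gamma (1/2)) ^ 2).
  { set (q := INR n + 1/2 + 1) in *. set (G := poch (1/2) n * Gamma (1/2)) in *.
    assert (HGp : 0 < G) by (unfold G; now apply Rmult_lt_0_compat).
    assert (Hsq : sqrt q * sqrt q = q) by (apply sqrt_sqrt; unfold q; lra).
    assert (H3 : ((INR n + 1) * INR (Factorial.fact n)) ^ 2 <= ((INR n + 1/2) * G * sqrt q) ^ 2).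
    { apply pow_incr. split; [apply Rmult_le_pos; lra|exact H1]. }
    replace (((INR n + 1/2) * G * sqrt q) ^ 2)
      with ((INR n + 1/2) ^ 2 * G ^ 2 * (sqrt q * sqrt q)) in H3 by ring.
    rewrite Hsq in H3.
    apply Rmult_le_reg_l with ((INR n + 1) ^ 2); [nra|].
    apply Rle_trans with ((INR n + 1/2) ^ 2 * G ^ 2 * q); [lra|].
    replace ((INR n + 1) ^ 2 * ((INR n + 1/2) * G ^ 2))
      with ((INR n + 1/2) * G ^ 2 * (INR n + 1) ^ 2) by ring.
    replace ((INR n + 1/2) ^ 2 * G ^ 2 * q) with ((INR n + 1/2) * G ^ 2 * ((INR n + 1/2) * q)) by ring.
    apply Rmult_le_compat_l; [apply Rmult_le_pos; [lra|apply pow2_ge_0]|]. unfold q. nra. }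
  pose proof (wallis_even n) as He. pose proof (wallis_odd n) as Ho.
  set (f := INR (Factorial.fact n)) in *. set (p := poch (1/2) n) in *.
  set (w0 := wallis (2 * n)) in *. set (w1 := wallis (2 * n + 1)) in *.
  assert (Hw0 : w0 = PI / 2 * p / f) by (rewrite <- He; field; lra).
  assert (Hw1 : w1 = f / ((2 * INR n + 1) * p)) by (rewrite <- Ho; field; lra).
  rewrite Hw0, Hw1 in HW.
  apply (Rmult_le_compat_r (2 * f / p)) in HW.
  2:{ left. apply Rdiv_lt_0_compat; lra. }
  replace ((INR n + 1 / 2) / (INR n + 1) * (PI / 2 * p / f) * (2 * f / p))
    with (PI * (INR n + 1/2) / (INR n + 1)) in HW by (field; lra).
  eapply Rle_trans; [exact HW|].
  replace (f / ((2 * INR n + 1) * p) * (2 * f / p)) with (f ^ 2 / ((INR n + 1/2) * p ^ 2)) by (field; lra).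
  apply Rle_div_l; [apply Rmult_lt_0_compat; [lra|nra]|].
  eapply Rle_trans; [exact H2|]. right. ring.
Qed.

(** If Gamma(1/2)^2 were below PI, the bounds of [Gamma_half_ge], which tend to PI, would exceed it
    for large n. *)
Lemma sqrt_PI_le_Gamma_half : sqrt PI <= Gamma (1/2).
Proof.
  pose proof PI_RGT_0. pose proof (Gamma_pos (1/2) ltac:(lra)) as HG.
  rewrite <- (sqrt_pow2 (Gamma (1/2))) by lra. apply sqrt_le_1_alt.
  apply Rnot_lt_le. intros Hlt.
  destruct (INR_unbounded (PI / (PI - Gamma (1/2) ^ 2))) as [n Hn].
  pose proof (Gamma_half_ge n) as H1. pose proof (pos_INR n).
  set (X := Gamma (1/2) ^ 2) in *.
  assert (Hn' : PI < INR n * (PI - X)) by (apply Rlt_div_l; lra).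
  assert (H1' : PI * (INR n + 1/2) <= X * (INR n + 1)) by (apply Rle_div_l; lra).
  lra.
Qed.

Lemma Phi0_half_le : Phi0 (-1/2) <= sqrt (2 / PI).
Proof.
  unfold Phi0. replace (- (-1/2)) with (/ 2) by field. replace (-1/2 + 1) with (1/2) by field.
  pose proof PI_RGT_0.
  rewrite Rpower_sqrt, sqrt_div by lra. pose proof sqrt_PI_le_Gamma_half.
  pose proof (sqrt_lt_R0 PI ltac:(lra)).
  apply Rmult_le_compat_l; [apply sqrt_pos|]. now apply Rinv_le_contravar.
Qed.

(** * The two-sided bound *)

Lemma continuous_0_ge (phi : R -> R) (d X : R) : 0 < d -> continuous phi 0 ->
  (forall t, 0 < t -> t < d -> X <= phi t) -> X <= phi 0.
Proof.
  intros Hd Hc H. apply Rnot_lt_le. intros Hlt.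
  assert (He : 0 < X - phi 0) by lra.
  destruct (proj1 (filterlim_locally phi (phi 0)) Hc (mkposreal _ He)) as [[e He'] Hb].
  set (t := Rmin (d / 2) (e / 2)).
  assert (Ht : 0 < t) by (apply Rmin_pos; lra).
  assert (Ht1 : t <= d / 2) by apply Rmin_l. assert (Ht2 : t <= e / 2) by apply Rmin_r.
  specialize (Hb t). simpl in Hb. unfold ball in Hb; simpl in Hb.
  unfold AbsRing_ball, abs, minus, plus, opp in Hb; simpl in Hb.
  assert (Hb' : Rabs (phi t + - phi 0) < X - phi 0).
  { apply Hb. rewrite Ropp_0, Rplus_0_r, Rabs_right; lra. }
  apply Rabs_def2 in Hb'. specialize (H t Ht ltac:(lra)). lra.
Qed.

Lemma shifted_Phi_le (nu x : R) : -1/2 < nu -> 0 < x ->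
  Rpower (x + (nu / 2 + 1/4)) (nu + 1/2) * Phi nu x <= Phi0 (-1/2).
Proof.
  intros Hnu Hx. set (s := nu / 2 + 1/4). assert (Hs : 0 < s) by (unfold s; lra).
  (* In t = 1/y the limit y -> oo becomes the value at 0: (y + s)^(nu+1/2) is (1 + s t)^(nu+1/2)
     times y^(nu+1/2), and the second factor is absorbed by the asymptotic bound. *)
  set (phi := fun t => Rpower (1 + s * t) (nu + 1/2) * (Phi0 (-1/2) * ((1 + 2 * t) * (1 + t / 2)))).
  assert (E : phi 0 = Phi0 (-1/2)).
  { unfold phi. rewrite Rmult_0_r, Rplus_0_r. unfold Rpower. rewrite ln_1, Rmult_0_r, exp_0. field. }
  rewrite <- E. apply continuous_0_ge with (/ x).
  - now apply Rinv_0_lt_compat.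
  - apply (ex_derive_continuous (V := R_NormedModule)). unfold phi, Rpower. auto_derive. lra.
  - intros t Ht Htx. set (y := / t). assert (Hy : 0 < y) by now apply Rinv_0_lt_compat.
    assert (Et : t = / y) by (unfold y; now rewrite Rinv_inv).
    assert (Hxy : x <= y).
    { left. unfold y. rewrite <- (Rinv_inv x). apply Rinv_lt_contravar; [|assumption].
      apply Rmult_lt_0_compat; [assumption|now apply Rinv_0_lt_compat]. }
    eapply Rle_trans; [apply (shifted_Phi_nondecreasing nu s x y); unfold s in *; lra|].
    unfold phi. rewrite Et.
    replace (y + s) with ((1 + s * / y) * y) by (field; lra).
    assert (0 < s * / y) by (apply Rmult_lt_0_compat; [assumption|now apply Rinv_0_lt_compat]).
    rewrite <- Rpower_mult_distr, Rmult_assoc by lra.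
    apply Rmult_le_compat_l; [left; apply Rpower_pos|].
    eapply Rle_trans; [apply Phi_asymptotic_le; lra|].
    right. field. lra.
Qed.

Lemma Phi_upper_bound (nu x : R) : -1/2 < nu -> 0 < x ->
  Phi nu x < sqrt (2 / PI) * / Rpower (x + nu/2 + 1/4) (nu + 1/2).
Proof.
  intros Hnu Hx. pose proof (Rpower_pos (x + nu/2 + 1/4) (nu + 1/2)) as HR.
  apply Rmult_lt_reg_l with (Rpower (x + nu/2 + 1/4) (nu + 1/2)); [assumption|].
  replace (Rpower (x + nu/2 + 1/4) (nu + 1/2) * (sqrt (2 / PI) * / Rpower (x + nu/2 + 1/4) (nu + 1/2)))
    with (sqrt (2 / PI)) by (field; lra).
  replace (x + nu/2 + 1/4) with (x + (nu/2 + 1/4)) by ring.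
  (* Passing to the limit gives only <=; the strict increase from x to x + 1 restores <. *)
  eapply Rlt_le_trans; [|eapply Rle_trans; [apply (shifted_Phi_le nu (x + 1)); lra|apply Phi0_half_le]].
  rewrite !Phi_eq_kummer by lra.
  pose proof (shifted_kummer_increasing (nu + 1/2) (nu/2 + 1/4) x (x + 1)
    ltac:(lra) ltac:(lra) Hx ltac:(lra) ltac:(lra)).
  pose proof (Phi0_pos nu ltac:(lra)). nra.
Qed.

Lemma Phi_lower_bound (nu x : R) : -1/2 < nu -> 0 < x ->
  Rpower (nu + 1/2) (nu + 1/2)
    / (Rpower 2 (2 * nu + 1/2) * Gamma (nu + 1) * Rpower (x + nu/2 + 1/4) (nu + 1/2)) < Phi nu x.
Proof.
  intros Hnu Hx. set (a := nu + 1/2). assert (Ha : 0 < a) by (unfold a; lra).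
  replace (x + nu/2 + 1/4) with (x + a / 2) by (unfold a; field).
  rewrite Phi_eq_kummer by lra. fold a.
  assert (H0 : Rpower (a / 2) a <= Rpower (x / 2 + a / 2) a * kummer_g a (x / 2)).
  (* The sign is reversed because [continuous_0_ge] bounds the value at 0 from below. *)
  { set (phi := fun t => - (Rpower (t + a / 2) a * kummer_g a t)).
    assert (E : - phi 0 = Rpower (a / 2) a).
    { unfold phi. rewrite kummer_g_0, Rplus_0_l. ring. }
    rewrite <- E. enough (- (Rpower (x / 2 + a / 2) a * kummer_g a (x / 2)) <= phi 0) by lra.
    apply continuous_0_ge with (x / 2); [lra| |].
    - unfold phi. apply (continuous_opp (V := R_NormedModule)).
      apply continuous_Rmult; [|apply continuous_kummer_g; lra].
      apply (ex_derive_continuous (V := R_NormedModule)). unfold Rpower. auto_derive. lra.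
    - intros t Ht Htx. unfold phi. apply Ropp_le_contravar.
      apply shifted_kummer_nondecreasing; lra. }
  (* The limit at 0 is compared with the value at x/2, and the strict increase from x/2 to x makes
     the bound strict. *)
  pose proof (shifted_kummer_increasing a (a / 2) (x / 2) x Ha ltac:(lra) ltac:(lra) ltac:(lra) ltac:(lra)) as H1.
  pose proof (Rpower_pos (x + a / 2) a) as HR. pose proof (Phi0_pos nu ltac:(lra)) as HP.
  apply Rmult_lt_reg_l with (Rpower (x + a / 2) a); [assumption|].
  (* The limit K (a/2)^a is the stated constant, because the exponents of 2 add up to nu + a = 2 nu
     + 1/2. *)
  apply Rle_lt_trans with (Phi0 nu * Rpower (a / 2) a); [right|].
  - unfold Phi0. rewrite Rpower_Rdiv by lra.
    replace (2 * nu + 1/2) with (nu + a) by (unfold a; field).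
    rewrite (Rpower_plus nu a 2), Rpower_Ropp.
    pose proof (Rpower_pos 2 nu). pose proof (Rpower_pos 2 a). pose proof (Gamma_pos (nu + 1) ltac:(lra)).
    field. lra.
  - replace (Rpower (x + a / 2) a * (Phi0 nu * kummer_g a x))
      with (Phi0 nu * (Rpower (x + a / 2) a * kummer_g a x)) by ring.
    apply Rmult_lt_compat_l; lra.
Qed.

Theorem theorem1 :
  (* (a) *)
  (forall nu, -1/2 <= nu -> completely_monotonic (Phi nu)) /\
  (* (b) *)
  (forall nu, -1/2 <= nu -> log_convex_pos (Phi nu) /\ geom_concave_pos (Phi nu)) /\
  (* (c) *)
  (forall x nu1 nu2, 0 < x -> 0 <= nu1 -> nu1 <= nu2 -> Phi nu2 x <= Phi nu1 x) /\
  (* (d) *)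
  (forall nu x y, -1/2 <= nu -> 0 < x -> x <= y ->
     Rpower x (nu + 1/2) * Phi nu x <= Rpower y (nu + 1/2) * Phi nu y) /\
  (* (e) : on the part of (0,oo) where the base x + nu/2 is positive *)
  (forall nu x y, -1/2 <= nu -> 0 < x -> 0 < x + nu/2 -> x <= y ->
     Rpower (x + nu/2) (nu + 1/2) * Phi nu x <= Rpower (y + nu/2) (nu + 1/2) * Phi nu y) /\
  (* (f) *)
  (forall nu x y, -1/2 <= nu -> 0 < x -> x <= y ->
     Rpower (x + nu/2 + 1/4) (nu + 1/2) * Phi nu x
       <= Rpower (y + nu/2 + 1/4) (nu + 1/2) * Phi nu y) /\
  (* (g) *)
  (forall nu x, -1/2 < nu -> 0 < x ->
     Rpower (nu + 1/2) (nu + 1/2)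
       / (Rpower 2 (2 * nu + 1/2) * Gamma (nu + 1) * Rpower (x + nu/2 + 1/4) (nu + 1/2))
       < Phi nu x /\
     Phi nu x < sqrt (2 / PI) * / Rpower (x + nu/2 + 1/4) (nu + 1/2)).
Proof.
  split; [exact Phi_completely_monotonic|].
  split; [intros nu Hnu; split; [now apply Phi_log_convex|now apply Phi_geom_concave]|].
  split; [exact Phi_antitone|].
  split.
  { intros nu x y Hnu Hx Hxy.
    pose proof (shifted_Phi_nondecreasing nu 0 x y Hnu ltac:(lra) Hx ltac:(lra) Hxy) as H.
    now rewrite !Rplus_0_r in H. }
  split; [intros nu x y Hnu Hx Hxs Hxy; apply shifted_Phi_nondecreasing; lra|].
  split.
  { intros nu x y Hnu Hx Hxy. rewrite !(Rplus_assoc _ (nu/2)).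
    apply shifted_Phi_nondecreasing; lra. }
  intros nu x Hnu Hx. split; [now apply Phi_lower_bound|now apply Phi_upper_bound].
Qed.
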